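(* Let $d\ge 5$ be an integer, and let $u\in S$ be a $2$-bounded monomial of degree $d$ with $x_1^2\nmid u$. Write $d=2m$ if $d$ is even and $d=2m+1$ if $d$ is odd. Then $B_2(u)$ is Freiman if and only if $u$ is one of the following monomials: (1) $u=x_1\left(\prod_{i=2}^{m}x_i^2\right)x_{m+1}$ if $d=2m$; $u=x_1\prod_{i=2}^{m+1}x_i^2$ if $d=2m+1$; (2) $u=x_1\left(\prod_{i=2}^{m}x_i^2\right)x_{m+2}$ if $d=2m$; $u=x_1\left(\prod_{i=2}^{m}x_i^2\right)x_{m+1}x_{m+2}$ if $d=2m+1$; (3) $u=x_1\left(\prod_{i=2}^{m-1}x_i^2\right)x_{m}x_{m+1}^2$ if $d=2m$; $u=x_1\left(\prod_{i=2}^{m}x_i^2\right)x_{m+2}^2$ if $d=2m+1$.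
   Context: Throughout, $n\ge 3$ is an integer, $K$ is a field, $S=K[x_1,\ldots,x_n]$ is the polynomial ring and $\mathfrak m=(x_1,\ldots,x_n)$. All monomials mentioned are monomials of $S$. For a monomial ideal $I\subset S$, $G(I)$ is its unique minimal set of monomial generators and $\mu(I)=|G(I)|$. $I$ is equigenerated if all elements of $G(I)$ have the same degree. The analytic spread $\ell(I)$ is the Krull dimension of the fiber ring $F(I)=\bigoplus_{k\ge 0}I^k/\mathfrak m I^k$. An equigenerated monomial ideal $I$ is called Freiman if $\mu(I^2)=\ell(I)\mu(I)-\binom{\ell(I)}{2}$. For a monomial $u$, $\mathrm{supp}(u)=\{i: x_i\mid u\}$. Let $k$ be a positive integer. A monomial $x_1^{a_1}\cdots x_n^{a_n}$ is $k$-bounded if $a_i\le k$ for all $i$. A monomial ideal $I$ generated by $k$-bounded monomials is $k$-Borel if for every $k$-bounded monomial $u\in I$, every $j\in\mathrm{supp}(u)$ and every $i<j$ one has $x_i(u/x_j)\in I$ provided $x_i(u/x_j)$ is again $k$-bounded. For a $k$-bounded monomial $u$, $B_k(u)$ is the unique smallest (with respect to inclusion) $k$-Borel ideal containing $u$. Convention: an empty product equals $1$. *)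

(* Defs.v *)
From HB Require Import structures.
From mathcomp Require Import all_boot all_order all_algebra.
From mathcomp Require Import mpoly.
From mathcomp Require Import boolp classical_sets functions cardinality finmap.

Set Implicit Arguments.
Unset Strict Implicit.
Unset Printing Implicit Defensive.

Import GRing.Theory.

Local Open Scope classical_set_scope.
Local Open Scope ring_scope.

Section Ideals.
Variable R : comNzRingType.
Implicit Types A B X : set R.

(* The unit ideal is allowed, unlike in idealr_closed. *)
Definition is_ideal A : Prop :=
  [/\ A 0, (forall a b, A a -> A b -> A (a + b))
         & (forall r a, A a -> A (r * a))].

Definition ideal_gen X : set R := smallest is_ideal X.

Definition ideal_mul A B : set R :=
  ideal_gen [set a * b | a in A & b in B].

Definition ideal_exp A (k : nat) : set R := iter k (ideal_mul A) setT.

Lemma ideal_gen_ideal X : is_ideal (ideal_gen X).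
Proof.
split=> [C [[]]//|a b Xa Xb C CX|r a Xa C CX].
- by case: (CX) => -[_ CD _] _; apply: CD; [apply: Xa | apply: Xb].
- by case: (CX) => -[_ _ CM] _; apply: CM; apply: Xa.
Qed.

Lemma ideal_exp_ideal A k : is_ideal (ideal_exp A k).
Proof. by case: k => [//|k]; apply: ideal_gen_ideal. Qed.

Lemma ideal_gen_min X A : is_ideal A -> X `<=` A -> ideal_gen X `<=` A.
Proof. by move=> idA XA a; apply. Qed.

Lemma ideal_gen_incl X : X `<=` ideal_gen X.
Proof. by move=> a Xa C [_]; apply. Qed.

Lemma is_ideal_colon A B : is_ideal A ->
  is_ideal [set a | forall b, B b -> A (a * b)].
Proof.
move=> [A0 AD AM]; split=> [b _|a a' Aa Aa' b Bb|r a Aa b Bb].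
- by rewrite mul0r.
- by rewrite mulrDl; apply: AD; [apply: Aa | apply: Aa'].
- by rewrite -mulrA; apply/AM/Aa.
Qed.

Lemma ideal_expD A k l a b :
  ideal_exp A k a -> ideal_exp A l b -> ideal_exp A (k + l) (a * b).
Proof.
elim: k a b => [|k IH] a b.
  by rewrite add0n => _ Ab; have [_ _] := ideal_exp_ideal A l; apply.
move=> Aa Ab; pose C := [set c | forall b, ideal_exp A l b ->
                                 ideal_exp A (k.+1 + l) (c * b)].
apply: (ideal_gen_min (A := C)) Aa b Ab.
  by apply: is_ideal_colon; apply: ideal_exp_ideal.
move=> _ [x Ax [y Ay <-]] b Ab; rewrite -mulrA.
by apply: ideal_gen_incl; exists x => //; exists (y * b) => //; apply: IH.
Qed.

Definition prime_ideal (P : set R) : Prop :=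
  idealr_closed (mem P) /\ prime_idealr_closed (mem P).

Definition prime_chain (l : nat) (P : nat -> set R) : Prop :=
  (forall i, (i <= l)%N -> prime_ideal (P i)) /\
  (forall i, (i < l)%N -> P i `<` P i.+1).

Definition krull_dim (l : nat) : Prop :=
  (exists P, prime_chain l P) /\
  (forall l' P, prime_chain l' P -> (l' <= l)%N).

(* The Rees algebra \bigoplus_k A^k t^k, as a subring of R[t]. *)
Definition rees_pred A : {pred {poly R}} :=
  fun p : {poly R} => `[< forall k, ideal_exp A k p`_k >].

Lemma rees_subring_closed A : subring_closed (rees_pred A).
Proof.
have reesP (p : {poly R}) : reflect (forall k, ideal_exp A k p`_k) (p \in rees_pred A).
  exact: asboolP.
have sum0 k (I : finType) (F : I -> R) :
    (forall i, ideal_exp A k (F i)) -> ideal_exp A k (\sum_i F i).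
  move=> AF; have [A0 AD _] := ideal_exp_ideal A k.
  by apply: (big_ind (ideal_exp A k)).
split=> [|p q /reesP Ap /reesP Aq|p q /reesP Ap /reesP Aq]; apply/reesP => k.
- have [A0 _ _] := ideal_exp_ideal A k.
  by rewrite coef1; case: k A0.
- have [_ AD AM] := ideal_exp_ideal A k.
  by rewrite coefB -mulN1r; apply: AD => //; apply: AM.
- rewrite coefM; apply: sum0 => i.
  by rewrite -[X in ideal_exp A X](@subnKC i) -1?ltnS//; apply: ideal_expD.
Qed.

HB.instance Definition _ A :=
  GRing.isSubringClosed.Build _ (rees_pred A) (rees_subring_closed A).

Record rees (A : set R) :=
  Rees { rees_val : {poly R}; rees_valP : rees_val \in rees_pred A }.

HB.instance Definition _ A := [isSub for @rees_val A].
HB.instance Definition _ A := [Choice of rees A by <:].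
HB.instance Definition _ A :=
  [SubChoice_isSubComNzRing of rees A by <:].

End Ideals.

Section FiberRing.
Variables (K : fieldType) (n : nat).
Local Notation S := {mpoly K[n]}.

Definition max_ideal : set S := ideal_gen (range (fun i : 'I_n => 'X_i : S)).

Lemma max_ideal_coef0 (p : S) : max_ideal p -> p@_0%MM = 0.
Proof.
move=> mp; apply: (ideal_gen_min (A := [set p : S | p@_0%MM = 0])) mp.
  split=> [|a b /= a0 b0|r a /= a0]; first by rewrite /= mcoeff0.
    by rewrite mcoeffD a0 b0 addr0.
  by rewrite (rmorphM (@mcoeff n K 0%MM)) /= a0 mulr0.
by move=> _ [i _ <-]; rewrite /= mcoeffX mnm1_eq0.
Qed.

(* The ideal \bigoplus_k m I^k t^k of the Rees algebra. *)
Definition fiber_pred (I : set S) : {pred rees I} :=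
  fun p => `[< forall k, ideal_mul max_ideal (ideal_exp I k) (rees_val p)`_k >].

Lemma fiber_idealr_closed (I : set S) : idealr_closed (@fiber_pred I).
Proof.
have fP p : reflect
    (forall k, ideal_mul max_ideal (ideal_exp I k) (rees_val p)`_k)
    (p \in @fiber_pred I).
  exact: asboolP.
have idm k := ideal_gen_ideal
  [set a * b | a in max_ideal & b in ideal_exp I k].
split=> [||a u v /fP mu /fP mv].
- by apply/fP => k; rewrite coef0; have [] := idm k.
- apply/negP => /fP /(_ 0%N); rewrite coef1 eqxx => m1.
  have /max_ideal_coef0 : max_ideal 1.
    apply: (ideal_gen_min (ideal_gen_ideal _)) m1 => _ [x mx [y _ <-]].
    by rewrite mulrC; have [_ _] := ideal_gen_ideal
      (range (fun i : 'I_n => 'X_i : S)); apply.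
  by rewrite mcoeff1 eqxx => /eqP; rewrite oner_eq0.
- apply/fP => k; have [m0 mD _] := idm k.
  rewrite coefD; apply: (mD) (mv k); rewrite coefM.
  apply: (big_ind (ideal_mul max_ideal (ideal_exp I k)) m0 mD) => i _.
  have := mu (k - i)%N; set c := (rees_val u)`_ _.
  have /asboolP/(_ i) := rees_valP a; set b := (rees_val a)`_ _ => Ib mc.
  rewrite mulrC; pose C := [set c | forall b, ideal_exp I i b ->
                             ideal_mul max_ideal (ideal_exp I k) (c * b)].
  apply: (ideal_gen_min (A := C)) mc b Ib.
    by apply: is_ideal_colon; apply: idm.
  move=> _ [x mx [y Iy <-]] b Ib; rewrite -mulrA.
  apply: ideal_gen_incl; exists x => //; exists (y * b) => //.
  by rewrite -[k in ideal_exp _ k](@subnK i) -1?ltnS//; apply: ideal_expD.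
Qed.

HB.instance Definition _ (I : set S) :=
  isIdealr.Build _ (@fiber_pred I) (fiber_idealr_closed I).

(* \bigoplus_k I^k / m I^k *)
Definition fiber_ring (I : set S) : comNzRingType :=
  {ideal_quot (@fiber_pred I)}.

Definition analytic_spread (I : set S) (l : nat) : Prop :=
  krull_dim (fiber_ring I) l.

End FiberRing.

Section MonomialIdeals.
Variables (K : fieldType) (n : nat).
Local Notation S := {mpoly K[n]}.
Local Notation mon := 'X_{1..n}.
Implicit Types (I : set S) (u : mon).

Definition mon_ideal (A : set mon) : set S :=
  ideal_gen [set 'X_[u] | u in A].

Definition monomial_ideal I : Prop := exists A, I = mon_ideal A.

Definition minimal_mon_gens I (A : set mon) : Prop :=
  I = mon_ideal A /\ (forall A', A' `<=` A -> I = mon_ideal A' -> A' = A).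

(* A monomial ideal has exactly one minimal set of monomial generators, finite
   by Dickson's lemma; get selects it. *)
Definition mon_gens I : set mon := get (minimal_mon_gens I).

Definition mu I : nat := #|` fset_set (mon_gens I)|.

Definition equigenerated I : Prop :=
  exists d, forall u, mon_gens I u -> mdeg u = d.

Definition freiman I : Prop :=
  [/\ monomial_ideal I, equigenerated I &
      exists2 l : nat, analytic_spread I l &
        (mu (ideal_exp I 2))%:Z = l%:Z * (mu I)%:Z - 'C(l, 2)%:Z].

Definition bounded (k : nat) u : Prop := forall i : 'I_n, (u i <= k)%N.

Definition borel (k : nat) I : Prop :=
  (exists2 A : set mon, A `<=` bounded k & I = mon_ideal A) /\
  (forall u, bounded k u -> I 'X_[u] ->
   forall i j : 'I_n, (0 < u j)%N -> (i < j)%N ->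
     let v := (u - U_(j) + U_(i))%MM in bounded k v -> I 'X_[v]).

Definition principal_borel (k : nat) u : set S :=
  smallest (borel k) [set 'X_[u]].

(* The variable x_i, indexed from 1 as on paper.  It is 0 when no such variable
   exists, so that a monomial is never equal to a product involving it. *)
Definition xvar (i : nat) : S := \sum_(j < n | j.+1 == i) 'X_j.

End MonomialIdeals.

Arguments principal_borel K {n} k u.
Arguments xvar {K n} i.

(* Main.v *)
(* Write A for the exponent vectors generating B_2(u) : the 2-bounded vectors of the
   degree of u whose partial sums dominate those of u. The fiber ring is K[A]. If x_r
   is the last variable of u then, as x_1^2 does not divide u, its Krull dimension and
   the rank of A are both r, so that Freiman's condition reads
   |A + A| = r |A| - binomial(r, 2) : equality in Freiman's lower bound for sumsets.

   The surplus |A + A| - rk(A) |A| + binomial(rk(A), 2) does not decrease when a point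
   outside of the convex hull of a set is added to it. Hence it is positive as soon as
   A contains, as a convex subset, an octahedron or a product of two triangles. One of
   these exists unless u = x_1 x_2^2 ... x_(r-2)^2 x_(r-1)^p x_r^q, and for these
   monomials A and A + A are counted directly; the three cases of the theorem list the
   possible p and q according to the parity of the degree. *)
Require Import Defs.
From HB Require Import structures.
From mathcomp Require Import all_boot all_order all_algebra.
From mathcomp Require Import mpoly.
From mathcomp Require Import boolp classical_sets functions cardinality finmap.
From mathcomp Require Import zify ring lra.

Set Implicit Arguments.
Unset Strict Implicit.
Unset Printing Implicit Defensive.

Import Order.TTheory GRing.Theory Num.Theory.

Local Open Scope fset_scope.
Local Open Scope ring_scope.

(** * Monomial ideals *)

(** Adding a new largest point a cannot lower the surplus. If the rank stays r, then 2a and at least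
    r - 1 sums b + a are new, because the differences b - a with b + a new span all differences; if
    the rank rises, every sum b + a is new. The octahedron and the product of two triangles exceed
    Freiman's bound by exactly one: 19 = 4 . 6 - 6 + 1 and 36 = 5 . 9 - 10 + 1. The Krull dimension
    is that of chains of primes. Elements picked from the steps of a chain are algebraically
    independent, and comparing growth bounds their number by r; a chain of length r is given by the
    kernels of substitutions that identify the variables one by one. These kernels differ because of
    exchanges inside A: if x_j has exponent at most 1 in u, a factor x_r can become x_j; otherwise a
    factor x_j can become x_1, which has room as x_1^2 does not divide u. The same exchanges give
    the rank of A. As the surplus is never negative, the final count needs only a lower bound for
    |A| and an upper bound for |A + A|. *)

Definition madd n (A B : set 'X_{1..n}) : set 'X_{1..n} :=
  [set w | exists2 a, A a & exists2 b, B b & w = (a + b)%MM].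

Fixpoint mset_mul n (A : set 'X_{1..n}) k : set 'X_{1..n} :=
  if k is k'.+1 then madd A (mset_mul A k') else [set 0%MM].

Section MonomialIdealMembership.
Variables (K : fieldType) (n : nat).
Local Notation S := {mpoly K[n]}.
Local Notation mon := 'X_{1..n}.
Implicit Types (A B : set mon) (p q : S).

Lemma ideal_sum (R : comNzRingType) (I : set R) (T : eqType) (s : seq T)
    (F : T -> R) :
  is_ideal I -> (forall i, i \in s -> I (F i)) -> I (\sum_(i <- s) F i).
Proof.
move=> [I0 ID _] IF; rewrite big_seq.
by apply: (big_ind I) => // i /IF.
Qed.

Lemma mon_idealP A p :
  mon_ideal (K:=K) A p <-> forall m, m \in msupp p -> exists2 a, A a & (a <= m)%MM.
Proof.
have [_ ID IM] := ideal_gen_ideal [set 'X_[K, a] | a in A].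
split=> [Ap|Hp].
  apply: (ideal_gen_min (A := [set p | forall m, m \in msupp p ->
    exists2 a, A a & (a <= m)%MM])) Ap.
    split=> [m|x y Hx Hy m|x y Hy m]; first by rewrite msupp0.
      by move/msuppD_le; rewrite mem_cat => /orP[/Hx|/Hy].
    move/msuppM_le/allpairsP => [[m1 m2] /= [_ /Hy[a Aa le_a] ->]].
    by exists a => //; apply: lepm_trans le_a (lem_addl _ _).
  by move=> _ [a Aa <-] m; rewrite msuppX inE => /eqP ->; exists a => //; apply: lepm_refl.
rewrite (mpolyE p); apply: ideal_sum => [|m /Hp[a Aa le_am]].
  exact: ideal_gen_ideal.
rewrite -mul_mpolyC -(submK le_am) mpolyXD mulrA.
by apply: IM; apply: ideal_gen_incl; exists a.
Qed.

Lemma mon_idealX A m : mon_ideal (K:=K) A 'X_[m] <-> exists2 a, A a & (a <= m)%MM.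
Proof.
split=> [/mon_idealP/(_ m)|[a Aa le_am]]; first by rewrite msuppX inE; apply.
by apply/mon_idealP => w; rewrite msuppX inE => /eqP ->; exists a.
Qed.

Lemma mon_ideal_mul A B :
  ideal_mul (mon_ideal (K:=K) A) (mon_ideal (K:=K) B) = mon_ideal (K:=K) (madd A B).
Proof.
apply/seteqP; split=> p.
  apply: ideal_gen_min; first exact: ideal_gen_ideal.
  move=> _ [x Ax [y By <-]]; apply/mon_idealP => m.
  move/msuppM_le/allpairsP => [[m1 m2] /= [m1x m2y ->]].
  have [a Aa le_a] := (mon_idealP A x).1 Ax _ m1x.
  have [b Bb le_b] := (mon_idealP B y).1 By _ m2y.
  exists (a + b)%MM; first by exists a => //; exists b.
  by apply/mnm_lepP => i; rewrite !mnmDE leq_add // (mnm_lepP _).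
apply: ideal_gen_min; first exact: ideal_gen_ideal.
move=> _ [_ [a Aa [b Bb ->]] <-]; rewrite mpolyXD; apply: ideal_gen_incl.
exists 'X_[a]; first by apply: ideal_gen_incl; exists a.
by exists 'X_[b] => //; apply: ideal_gen_incl; exists b.
Qed.

Lemma mon_ideal_exp A k : ideal_exp (mon_ideal (K:=K) A) k = mon_ideal (K:=K) (mset_mul A k).
Proof.
elim: k => [|k IHk] /=; last by rewrite IHk mon_ideal_mul.
apply/seteqP; split=> p // _; apply/mon_idealP => m _.
by exists 0%MM => //; apply/mnm_lepP => i; rewrite mnm0E.
Qed.

Lemma mset_mul1 A : mset_mul A 1 = A.
Proof.
apply/seteqP; split=> m /=; first by move=> [a Aa [b -> ->]]; rewrite addm0.
by move=> Am; exists m => //; exists 0%MM; rewrite ?addm0.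
Qed.

Lemma mset_mul2 A : mset_mul A 2 = madd A A.
Proof. by have := mset_mul1 A; rewrite /= => ->. Qed.

Definition mvars : set mon := [set m | exists i, m = U_(i)%MM].

Lemma max_ideal_mon : @max_ideal K n = mon_ideal (K:=K) mvars.
Proof.
rewrite /max_ideal /mon_ideal; congr ideal_gen; apply/seteqP; split=> p /=.
  by move=> [i _ <-]; exists U_(i)%MM => //; exists i.
by move=> [_ [i ->] <-]; exists i.
Qed.

Lemma mset_mul_mdeg A d k : (forall a, A a -> mdeg a = d) ->
  forall m, mset_mul A k m -> mdeg m = (k * d)%N.
Proof.
move=> Ad; elim: k => [|k IHk] m /=; first by move=> ->; rewrite mdeg0.
by move=> [a /Ad a_d [b /IHk b_d ->]]; rewrite mdegD a_d b_d mulSn.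
Qed.

Lemma lem_mdeg_eq (a b : mon) : (a <= b)%MM -> (mdeg b <= mdeg a)%N -> a = b.
Proof.
move=> le_ab; rewrite -{1}(submK le_ab) mdegD -{2}(add0n (mdeg a)) leq_add2r.
by rewrite leqn0 mdeg_eq0 => /eqP ab0; rewrite -(submK le_ab) ab0 add0m.
Qed.

(** In a single degree divisibility is equality. So every [B] generating the ideal contains [A]:
    some b divides a, some a' divides b, whence a' = a = b. Thus [A] is minimal, and so is equal to
    the minimal set that [get] selects. *)
Lemma mon_gens_equigenerated A d :
  (forall a, A a -> mdeg a = d) -> mon_gens (mon_ideal (K:=K) A) = A.
Proof.
move=> Ad.
have sub B : mon_ideal (K:=K) A = mon_ideal (K:=K) B -> (A `<=` B)%classic.
  move=> AB a Aa.
  have [b Bb le_ba]: exists2 b, B b & (b <= a)%MM.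
    by apply/mon_idealX; rewrite -AB; apply/mon_idealX; exists a => //; apply: lepm_refl.
  have [a' Aa' le_ab]: exists2 a', A a' & (a' <= b)%MM.
    by apply/mon_idealX; rewrite AB; apply/mon_idealX; exists b => //; apply: lepm_refl.
  have a'a : a' = a by apply: lem_mdeg_eq; [apply: lepm_trans le_ba | rewrite !Ad].
  suff -> : a = b by [].
  by apply/mnmP => i; apply/eqP; rewrite eqn_leq -{1}a'a !(mnm_lepP _).
have Amin : minimal_mon_gens (mon_ideal (K:=K) A) A.
  by split=> // B BA /sub AB; apply/seteqP; split.
by have [/[dup]/sub AB E] := getPex (ex_intro _ A Amin); move/(_ A AB erefl).
Qed.

End MonomialIdealMembership.

(** * Chains of prime ideals *)

Section KrullDimension.
Variable R : comNzRingType.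
Implicit Types P : set R.

Lemma prime_idealP P : prime_ideal P <->
  [/\ is_ideal P, ~ P 1 & forall x y, P (x * y) -> P x \/ P y].
Proof.
have memP x : (x \in mem P) = (x \in P) by [].
split.
  move=> [[P0 P1 PM] PP]; rewrite !memP in P0 P1.
  have {PM} PM a x y : P x -> P y -> P (a * x + y).
    by move=> Px Py; have := PM a x y; rewrite !memP !in_setE; apply.
  have {}P0 : P 0 by rewrite -in_setE.
  split; first split => //.
  - by move=> a b Pa Pb; rewrite -[a]mul1r; apply: PM.
  - by move=> r a Pa; rewrite -[_ * _]addr0; apply: PM.
  - by move=> /mem_set; apply/negP.
  - move=> x y /mem_set Pxy; have := PP x y; rewrite !memP => /(_ Pxy).
    by case/orP => /set_mem; [left | right].
move=> [[P0 PD PM] P1 PP]; split; first split.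
- by rewrite memP; apply: mem_set.
- by rewrite memP; apply/negP => /set_mem.
- move=> a x y; rewrite !memP => /set_mem Px /set_mem Py.
  by apply/mem_set/PD => //; apply: PM.
- move=> x y; rewrite !memP => /set_mem /PP[] /mem_set -> //; by rewrite orbT.
Qed.

Variables (K : fieldType) (iota : {rmorphism K -> R}) (l : nat).
Variables (P : nat -> set R) (y : nat -> R).
Hypothesis chainP : prime_chain l P.
Hypothesis y_in : forall i, (i < l)%N -> P i.+1 (y i).
Hypothesis y_notin : forall i, (i < l)%N -> ~ P i (y i).

Let Pprime i (le_il : (i <= l)%N) := (prime_idealP (P i)).1 (chainP.1 i le_il).

(** Exponents below [i] are ignored: the induction strips y_0, y_1, ... in turn and keeps the same
    exponent functions. *)
Definition chain_mon (i : nat) (e : {ffun 'I_l -> nat}) : R :=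
  \prod_(j < l | (i <= j)%N) y j ^+ e j.

Lemma chain_monS i (lt_il : (i < l)%N) e :
  chain_mon i e = y i ^+ e (Ordinal lt_il) * chain_mon i.+1 e.
Proof.
rewrite /chain_mon (bigD1 (Ordinal lt_il)) //=; congr (_ * _).
by apply: eq_bigl => j; rewrite ltn_neqAle andbC eq_sym.
Qed.

(* Divide by the smallest power of [y i] (allowed, as [y i] is not in the prime
   [P i]), then reduce modulo [P i.+1], which kills the other powers. *)
Lemma chain_mon_indep_aux k i (s : seq {ffun 'I_l -> nat})
    (c : {ffun 'I_l -> nat} -> K) :
    (i + k = l)%N -> s != [::] -> uniq s -> (forall e, e \in s -> c e != 0) ->
    (forall e e' (j : 'I_l), e \in s -> e' \in s -> (j < i)%N -> e j = e' j) ->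
  ~ P i (\sum_(e <- s) iota (c e) * chain_mon i e).
Proof.
elim: k i s => [|k IHk] i s.
  (* At [i = l] the exponent functions agree everywhere, so one term is left, a nonzero scalar,
     which lies in no prime ideal. *)
  rewrite addn0 => ->; case: s => [//|e [|e' s] _ us c0 agree]; last first.
    suff ee' : e = e' by move: us; rewrite ee' /= inE eqxx.
    by apply/ffunP => j; apply: agree => //; rewrite !inE eqxx ?orbT.
  rewrite big_seq1 /chain_mon big1 ?mulr1 => [|j /(leq_trans (ltn_ord j))]; last first.
    by rewrite ltnn.
  have [[_ _ PM] P1 _] := Pprime (leqnn l).
  move=> /(PM (iota (c e)^-1)); rewrite -rmorphM mulVf ?rmorph1 //.
  by rewrite c0 ?inE.
move=> ikl s0 us c0 agree.
have lt_il : (i < l)%N by lia.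
have [[Pi0 PiD PiM] Pi1 PiP] := Pprime (ltnW lt_il).
have [[PS0 PSD PSM] _ _] := Pprime lt_il.
have [subP _] := chainP.2 i lt_il.
pose o := Ordinal lt_il.
have [e0 e0s min_e0] : exists2 e0, e0 \in s & forall e, e \in s -> (e0 o <= e o)%N.
  have exm : exists m, has (fun e : {ffun 'I_l -> nat} => e o == m) s.
    by case: (s) s0 => // e s1 _; exists (e o); rewrite /= eqxx.
  case: (ex_minnP exm) => m /hasP[e0 e0s /eqP <-] min_m.
  by exists e0 => // e es; apply: min_m; apply/hasP; exists e.
move=> Ps.
pose F e := iota (c e) * (y i ^+ (e o - e0 o) * chain_mon i.+1 e).
have {}Ps : P i (\sum_(e <- s) F e).
  have : P i (y i ^+ (e0 o) * \sum_(e <- s) F e).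
    rewrite mulr_sumr; congr (P i _): Ps; rewrite !big_seq; apply: eq_bigr => e es.
    rewrite (chain_monS lt_il) /F -/o -{1}(subnK (min_e0 e es)) exprD; ring.
  case/PiP => //; elim: (e0 o) => [/Pi1 //|m IHm]; rewrite exprS => /PiP[] //.
  by move/y_notin => /(_ lt_il).
pose s' := [seq e : {ffun 'I_l -> nat} <- s | e o == e0 o].
apply: (IHk i.+1 s'); rewrite ?addSnnS //.
- by rewrite -has_filter; apply/hasP; exists e0.
- exact: filter_uniq.
- by move=> e; rewrite mem_filter => /andP[_ /c0].
- move=> e e' j; rewrite !mem_filter => /andP[/eqP eo es] /andP[/eqP e'o e's].
  rewrite ltnS leq_eqVlt => /predU1P[ji|]; last exact: agree.
  by rewrite (_ : j = o) ?eo ?e'o //; apply: val_inj.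
have -> : \sum_(e <- s') iota (c e) * chain_mon i.+1 e =
    \sum_(e <- s) F e + - 1 * \sum_(e <- s | (e : {ffun 'I_l -> nat}) o != e0 o) F e.
  rewrite [X in X + _](bigID (fun e : {ffun 'I_l -> nat} => e o == e0 o)) /=.
  rewrite mulN1r addrK big_filter.
  by apply: eq_bigr => e /eqP eo; rewrite /F eo subnn mul1r.
apply: (PSD); first exact: subP.
apply: (PSM); rewrite -big_filter; apply: ideal_sum => [|e]; first exact: (And3 PS0 PSD PSM).
rewrite mem_filter => /andP[ne es]; apply: (PSM); rewrite mulrC; apply: (PSM).
have lt_e : (e0 o < e o)%N by rewrite ltn_neqAle eq_sym ne min_e0.
rewrite -(@prednK (e o - e0 o)) ?subn_gt0 // exprSr.
by apply: (PSM); apply: y_in.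
Qed.

(** Zero lies in [P 0], and at [i = 0] the agreement condition is void, so the auxiliary lemma
    applies to the terms with nonzero coefficient: the y_i are algebraically independent over
    [K]. *)
Lemma chain_mon_indep (s : seq {ffun 'I_l -> nat}) (c : {ffun 'I_l -> nat} -> K) :
    uniq s -> \sum_(e <- s) iota (c e) * chain_mon 0 e = 0 ->
  forall e, e \in s -> c e = 0.
Proof.
move=> us sum0 e es; apply/eqP/negPn/negP => ce.
pose s' := [seq e : {ffun 'I_l -> nat} <- s | c e != 0].
apply: (@chain_mon_indep_aux l 0 s' c); rewrite ?filter_uniq //.
- by rewrite -has_filter; apply/hasP; exists e.
- by move=> e'; rewrite mem_filter => /andP[].
have -> : \sum_(e <- s') iota (c e) * chain_mon 0 e = 0.
  rewrite -[RHS]sum0 [RHS](bigID (fun e : {ffun 'I_l -> nat} => c e != 0)) /=.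
  rewrite [X in _ + X]big1 ?addr0 ?big_filter // => e'.
  by rewrite negbK => /eqP ->; rewrite rmorph0 mul0r.
by have [[]] := Pprime (leq0n l).
Qed.

End KrullDimension.

(** * The fiber ring of an equigenerated monomial ideal *)

Section Pihomog.
Variables (K : fieldType) (n : nat).
Local Notation S := {mpoly K[n]}.
Implicit Types (p q : S).

Lemma mcoeff_pihomog D p m :
  (pihomog mdeg D p)@_m = if mdeg m == D then p@_m else 0.
Proof.
rewrite pihomogE raddf_sum /=.
have -> : \sum_(w <- msupp p | mdeg w == D) (p@_w *: 'X_[w])@_m =
    \sum_(w <- msupp p | w == m) (if mdeg m == D then p@_m else 0).
  rewrite big_mkcond [RHS]big_mkcond /=; apply: eq_bigr => w _.
  rewrite mcoeffZ mcoeffX; have [->|_] := eqVneq w m; first by rewrite mulr1.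
  by rewrite mulr0 if_same.
have [mp|mp] := boolP (m \in msupp p).
  by rewrite -big_filter (filter_pred1_uniq (msupp_uniq p) mp) big_seq1.
rewrite (memN_msupp_eq0 mp) if_same big1_seq //.
Qed.

(** Since a and b bound the degrees from below, a term of degree a + b in the product can only come
    from the two lowest components. *)
Lemma pihomog_mul a b p q :
    (forall m, m \in msupp p -> (a <= mdeg m)%N) ->
    (forall m, m \in msupp q -> (b <= mdeg m)%N) ->
  pihomog mdeg (a + b) (p * q) = pihomog mdeg a p * pihomog mdeg b q.
Proof.
move=> ap bq; apply/mpolyP => m; rewrite mcoeff_pihomog !mcoeffM.
have z (s : S) c w : (forall m, m \in msupp s -> (c <= mdeg m)%N) ->
    (mdeg w < c)%N -> s@_w = 0.
  by move=> sc lt_w; apply/eqP; apply: contraLR lt_w; rewrite -mcoeff_msupp -leqNgt => /sc.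
case: ifP => [/eqP dm|/negbT dm]; last first.
  rewrite big1 // => -[k1 k2] /= /eqP/(congr1 (@mdeg n)); rewrite mdegD => km.
  rewrite !mcoeff_pihomog.
  case: eqP => [k1a|]; last by rewrite mul0r.
  case: eqP => [k2b|]; last by rewrite mulr0.
  by case/negP: dm; apply/eqP; rewrite km k1a k2b.
apply: eq_bigr => -[k1 k2] /= /eqP/(congr1 (@mdeg n)); rewrite mdegD => km; have {km} := etrans (esym km) dm.
rewrite !mcoeff_pihomog.
case: eqP => [->|ne1].
  by move/addnI => ->; rewrite eqxx.
move=> E; rewrite mul0r; have [lt1|] := ltnP (mdeg k1) a.
  by rewrite (z p a) ?mul0r.
by move=> le1; rewrite (z q b) ?mulr0 //; lia.
Qed.

End Pihomog.

Section FiberRingEmbedding.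
Variables (K : fieldType) (n d : nat) (A : set 'X_{1..n}).
Local Notation S := {mpoly K[n]}.
Local Notation I := (mon_ideal (K:=K) A).
Hypothesis Ad : forall a, A a -> mdeg a = d.

(* The fiber ring is K[A] : the class of a in I^k modulo m I^k is recorded by the
   homogeneous component of degree k d of a. *)
Definition rees_top (p : rees I) : {poly S} :=
  \poly_(k < size (rees_val p)) pihomog mdeg (k * d) (rees_val p)`_k.

Lemma coef_rees_top p k :
  (rees_top p)`_k = pihomog mdeg (k * d) (rees_val p)`_k.
Proof.
rewrite coef_poly; case: ltnP => // le_sz.
by rewrite nth_default ?pihomog0.
Qed.

Lemma rees_valE (p : rees I) k :
  mon_ideal (K:=K) (mset_mul A k) (rees_val p)`_k.
Proof. by have /asboolP/(_ k) := rees_valP p; rewrite mon_ideal_exp. Qed.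

Lemma rees_val_mdeg (p : rees I) k m :
  m \in msupp (rees_val p)`_k -> (k * d <= mdeg m)%N.
Proof.
have /mon_idealP H := @rees_valE p k => /H[a Aa /submK <-].
by rewrite mdegD (mset_mul_mdeg Ad Aa) leq_addl.
Qed.

(** A monomial of degree k d in I^k is divisible by a product of k generators of that same degree,
    hence equal to it. *)
Lemma rees_top_supp p k m : m \in msupp (rees_top p)`_k -> mset_mul A k m.
Proof.
rewrite coef_rees_top mcoeff_msupp mcoeff_pihomog.
case: ifP => [/eqP dm|]; last by rewrite eqxx.
rewrite -mcoeff_msupp; have /mon_idealP H := @rees_valE p k => /H[a Aa le_am].
by rewrite -(lem_mdeg_eq le_am) // dm (mset_mul_mdeg Ad Aa).
Qed.

Lemma rees_top_is_zmod_morphism : zmod_morphism rees_top.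
Proof.
move=> p q; apply/polyP => k.
by rewrite coefB !coef_rees_top -pihomogB -coefB.
Qed.

Lemma rees_top_is_monoid_morphism : monoid_morphism rees_top.
Proof.
split=> [|p q]; apply/polyP => k.
  rewrite coef_rees_top -[rees_val _]/(1 : {poly S}) !coef1.
  case: k => [|k]; last by rewrite pihomog0.
  by rewrite pihomog_dE // mul0n; apply: dhomog1.
rewrite coef_rees_top -[rees_val _]/(rees_val p * rees_val q) !coefM.
rewrite raddf_sum; apply: eq_bigr => i _; rewrite !coef_rees_top.
rewrite -pihomog_mul -?mulnDl ?subnKC -1?ltnS //; exact: rees_val_mdeg.
Qed.

HB.instance Definition _ := GRing.isZmodMorphism.Build (rees I) {poly S}
  rees_top rees_top_is_zmod_morphism.
HB.instance Definition _ := GRing.isMonoidMorphism.Build (rees I) {poly S}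
  rees_top rees_top_is_monoid_morphism.

(** Monomials of m I^k have degree above k d and leave no trace in degree k d. Conversely, if that
    component vanishes, every monomial present is a proper multiple of a product of k generators, so
    a variable splits off. *)
Lemma fiber_predE (p : rees I) : (p \in @fiber_pred K n I) = (rees_top p == 0).
Proof.
rewrite -[LHS]/(`[< _ >]); apply/asboolP/eqP => H.
  apply/polyP => k; rewrite coef0 coef_rees_top; apply/mpolyP => m.
  rewrite mcoeff_pihomog mcoeff0; case: eqP => // dm; apply/eqP/negPn/negP.
  move: (H k); rewrite mon_ideal_exp max_ideal_mon mon_ideal_mul.
  rewrite -mcoeff_msupp => /mon_idealP/[apply] -[_ [_ [i ->] [a Aa ->]]] /submK mE.
  by move: dm; rewrite -mE !mdegD mdeg1 (mset_mul_mdeg Ad Aa); lia.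
move=> k; rewrite mon_ideal_exp max_ideal_mon mon_ideal_mul; apply/mon_idealP => m mp.
have /mon_idealP/(_ _ mp)[a Aa le_am] := @rees_valE p k.
have [i ni] : exists i, (m - a)%MM i != 0%N.
  apply/existsP; rewrite -negb_forall; apply/negP => /forallP ma0.
  have ma : m = a.
    by rewrite -(submK le_am) (_ : m - a = 0)%MM ?add0m //; apply/mnmP => i;
       rewrite mnm0E; apply/eqP.
  have := coef_rees_top p k; rewrite H coef0 => /mpolyP/(_ m).
  rewrite mcoeff_pihomog mcoeff0 ma (mset_mul_mdeg Ad Aa) eqxx => /esym/eqP.
  by apply/negP; rewrite -mcoeff_msupp -ma.
exists (U_(i) + a)%MM; first by exists U_(i)%MM; [exists i | exists a].
apply/mnm_lepP => j; rewrite mnmDE mnm1E; have := mnm_lepP le_am j.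
by case: eqP => [<-|] /=; [move: ni; rewrite mnmBE; lia | ].
Qed.

Local Notation F := (fiber_ring I).

(** Evaluated at a chosen representative; by [fiber_top_pi] the choice does not matter. *)
Definition fiber_top (x : F) : {poly S} := rees_top (generic_quotient.repr x).

Definition fiber_pi (p : rees I) : F :=
  generic_quotient.pi {ideal_quot @fiber_pred K n I} p.

Lemma fiber_pi_surj x : exists p, x = fiber_pi p.
Proof. by exists (generic_quotient.repr x); rewrite /fiber_pi generic_quotient.reprK. Qed.

Lemma fiber_top_pi p : fiber_top (fiber_pi p) = rees_top p.
Proof.
apply/eqP; rewrite -subr_eq0 -raddfB -fiber_predE Quotient.idealrBE.
by rewrite generic_quotient.reprK.
Qed.

Lemma fiber_piB : {morph fiber_pi : p q / p - q}.
Proof. exact: (rmorphB (generic_quotient.pi {ideal_quot @fiber_pred K n I})). Qed.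

Lemma fiber_piM : {morph fiber_pi : p q / p * q}.
Proof. exact: (rmorphM (generic_quotient.pi {ideal_quot @fiber_pred K n I})). Qed.

Lemma fiber_pi1 : fiber_pi 1 = 1.
Proof. exact: (rmorph1 (generic_quotient.pi {ideal_quot @fiber_pred K n I})). Qed.

Lemma fiber_top_is_zmod_morphism : zmod_morphism fiber_top.
Proof.
move=> x y; have [p ->] := fiber_pi_surj x; have [q ->] := fiber_pi_surj y.
by rewrite -fiber_piB !fiber_top_pi raddfB.
Qed.

Lemma fiber_top_is_monoid_morphism : monoid_morphism fiber_top.
Proof.
split=> [|x y]; first by rewrite -fiber_pi1 fiber_top_pi rmorph1.
have [p ->] := fiber_pi_surj x; have [q ->] := fiber_pi_surj y.
by rewrite -fiber_piM !fiber_top_pi rmorphM.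
Qed.

HB.instance Definition _ := GRing.isZmodMorphism.Build F {poly S}
  fiber_top fiber_top_is_zmod_morphism.
HB.instance Definition _ := GRing.isMonoidMorphism.Build F {poly S}
  fiber_top fiber_top_is_monoid_morphism.

Lemma fiber_top_inj : injective fiber_top.
Proof.
apply: raddf_inj => x; have [p ->] := fiber_pi_surj x; rewrite [LHS]fiber_top_pi.
move=> /eqP; rewrite -fiber_predE -[X in X \in _]subr0 Quotient.idealrBE => /eqP E.
by rewrite /fiber_pi E; apply: (rmorph0 (generic_quotient.pi {ideal_quot @fiber_pred K n I})).
Qed.

Lemma fiber_gen a : A a -> exists x : F, fiber_top x = 'X_[a] *: 'X.
Proof.
move=> Aa; have Ia : ('X_[a] *: 'X : {poly S}) \in rees_pred I.
  apply/asboolP => -[|[|k]]; rewrite coefZ coefX ?mulr0 ?mulr1 //; last first.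
    by have [] := ideal_exp_ideal I k.+2.
  by rewrite mon_ideal_exp mset_mul1; apply: ideal_gen_incl; exists a.
exists (fiber_pi (Rees Ia)).
rewrite fiber_top_pi; apply/polyP => k; rewrite coef_rees_top coefZ coefX.
case: eqP => [->|_]; last by rewrite mulr0 pihomog0.
by rewrite mulr1 pihomog_dE // dhomogX mul1n; apply/eqP/Ad.
Qed.

Lemma fiber_const_subproof c : ((c%:MP)%:P : {poly S}) \in rees_pred I.
Proof.
apply/asboolP => k; rewrite coefC; case: k => [//|k] /=.
by have [] := ideal_exp_ideal I k.+1.
Qed.

Definition fiber_const (c : K) : F :=
  fiber_pi (Rees (fiber_const_subproof c)).

Lemma fiber_top_const c : fiber_top (fiber_const c) = (c%:MP)%:P.
Proof.
rewrite fiber_top_pi; apply/polyP => k; rewrite coef_rees_top coefC.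
case: k => [|k] /=; last by rewrite pihomog0.
by rewrite pihomog_dE // mul0n -alg_mpolyC dhomogZ // dhomog1.
Qed.

Lemma fiber_const_is_zmod_morphism : zmod_morphism fiber_const.
Proof.
move=> x y; apply: fiber_top_inj.
by rewrite raddfB /= !fiber_top_const mpolyCB polyCB.
Qed.

Lemma fiber_const_is_monoid_morphism : monoid_morphism fiber_const.
Proof.
split=> [|x y]; apply: fiber_top_inj; rewrite ?rmorphM ?rmorph1 /= !fiber_top_const.
  by rewrite mpolyC1.
by rewrite mpolyCM polyCM.
Qed.

HB.instance Definition _ := GRing.isZmodMorphism.Build K F
  fiber_const fiber_const_is_zmod_morphism.
HB.instance Definition _ := GRing.isMonoidMorphism.Build K F
  fiber_const fiber_const_is_monoid_morphism.

Definition fiber_emb : {rmorphism F -> {poly S}} := fiber_top.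
Definition fiber_scalar : {rmorphism K -> F} := fiber_const.

Lemma fiber_emb_inj : injective fiber_emb.
Proof. exact: fiber_top_inj. Qed.

Lemma fiber_emb_scalar c : fiber_emb (fiber_scalar c) = (c%:MP)%:P.
Proof. exact: fiber_top_const. Qed.

Lemma fiber_emb_supp x k m : m \in msupp (fiber_emb x)`_k -> mset_mul A k m.
Proof. exact: rees_top_supp. Qed.

Lemma fiber_emb_gen a : A a -> exists x, fiber_emb x = 'X_[a] *: 'X.
Proof. exact: fiber_gen. Qed.

End FiberRingEmbedding.

(** * Analytic spread *)

Lemma chain_mon_free (R : comNzRingType) (K : fieldType)
    (iota : {rmorphism K -> R}) (l : nat) (P : nat -> set R) (y : nat -> R)
    (T : finType) (emb : T -> {ffun 'I_l -> nat}) (c : T -> K) :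
    prime_chain l P -> (forall i, (i < l)%N -> P i.+1 (y i)) ->
    (forall i, (i < l)%N -> ~ P i (y i)) -> injective emb ->
    \sum_t iota (c t) * chain_mon y 0 (emb t) = 0 ->
  forall t, c t = 0.
Proof.
move=> chP y_in y_notin emb_inj sum0 t.
pose c' e := \sum_(t' | emb t' == e) c t'.
have c'E t' : c' (emb t') = c t'.
  by rewrite /c' (eq_bigl (pred1 t')) ?big_pred1_eq // => t'' /=; rewrite (inj_eq emb_inj).
rewrite -c'E; apply: (chain_mon_indep (iota := iota) chP y_in y_notin
  (s := [seq emb t' | t' <- enum T])); rewrite ?map_inj_uniq //.
- by rewrite -enumT enum_uniq.
- rewrite big_map big_enum /= -[RHS]sum0.
  by apply: eq_bigr => t' _; rewrite c'E.
- by apply: map_f; rewrite mem_enum.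
Qed.

Lemma kernel_prime (R : comNzRingType) (T : idomainType) (f : {rmorphism R -> T}) :
  prime_ideal [set x | f x = 0].
Proof.
apply/prime_idealP; split=> [|/=|x y /=].
- split=> [|x y /= fx fy|r x /= fx]; rewrite /= ?rmorph0 //.
    by rewrite rmorphD fx fy addr0.
  by rewrite rmorphM fx mulr0.
- by rewrite rmorph1 => /eqP; rewrite oner_eq0.
- by rewrite rmorphM => /eqP; rewrite mulf_eq0 => /orP[] /eqP; [left|right].
Qed.

Lemma mpolyX_neq0 (K : fieldType) n (m : 'X_{1..n}) : 'X_[m] != 0 :> {mpoly K[n]}.
Proof. by rewrite -msupp_eq0 msuppX. Qed.

Lemma mpoly_rmorph_ext (K : fieldType) n (R : comNzRingType)
    (f g : {rmorphism {mpoly K[n]} -> R}) :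
  (forall c, f c%:MP = g c%:MP) -> (forall i, f 'X_i = g 'X_i) -> f =1 g.
Proof.
move=> fgC fgX p; rewrite (mpolyE p) !rmorph_sum; apply: eq_bigr => m _ /=.
rewrite -mul_mpolyC !rmorphM /= fgC mpolyXE_id !rmorph_prod; congr (_ * _).
by apply: eq_bigr => i _; rewrite !rmorphXn /= fgX.
Qed.

(* The proof of existence is opaque, so that conversion never unfolds a
   substitution. *)
Fact msubst_exists (K : fieldType) n (h : 'I_n -> {mpoly K[n]}) :
  {f : {rmorphism {mpoly K[n]} -> {mpoly K[n]}} |
    (forall c, f c%:MP = c%:MP) & forall i, f 'X_i = h i}.
Proof.
exists (comp_mpoly [tuple h i | i < n]) => [c|i] /=; first exact: comp_mpolyC.
by rewrite comp_mpolyXU -tnth_nth tnth_mktuple.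
Qed.

Definition msubst (K : fieldType) n (h : 'I_n -> {mpoly K[n]}) :
  {rmorphism {mpoly K[n]} -> {mpoly K[n]}} := s2val (msubst_exists h).

Lemma msubstC (K : fieldType) n (h : 'I_n -> {mpoly K[n]}) c : msubst h c%:MP = c%:MP.
Proof. exact: (s2valP (msubst_exists h)). Qed.

Lemma msubstXU (K : fieldType) n (h : 'I_n -> {mpoly K[n]}) i : msubst h 'X_i = h i.
Proof. exact: (s2valP' (msubst_exists h)). Qed.

Lemma msubstX (K : fieldType) n (h : 'I_n -> {mpoly K[n]}) m :
  msubst h 'X_[m] = \prod_(i < n) h i ^+ m i.
Proof.
rewrite mpolyXE_id rmorph_prod; apply: eq_bigr => i _.
by rewrite rmorphXn /= msubstXU.
Qed.

Section AnalyticSpread.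
Variables (K : fieldType) (n d : nat) (A : set 'X_{1..n}) (t : 'I_n).
Local Notation S := {mpoly K[n]}.
Local Notation I := (mon_ideal (K:=K) A).
Local Notation F := (fiber_ring I).
Hypothesis d_gt0 : (0 < d)%N.
Hypothesis Ad : forall a, A a -> mdeg a = d.
Hypothesis At : forall a (i : 'I_n), A a -> (t < i)%N -> a i = 0%N.

Let phi : {rmorphism F -> {poly S}} := fiber_emb K Ad.

Lemma mset_mul_support k m (i : 'I_n) : mset_mul A k m -> (t < i)%N -> m i = 0%N.
Proof.
move=> Am lt_ti; elim: k m Am => [|k IHk] m /=; first by move=> ->; rewrite mnm0E.
by move=> [a Aa [b /IHk b0 ->]]; rewrite mnmDE b0 At.
Qed.

(** * Upper bound for chains of primes, by growth *)

Section UpperBound.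
Variables (l : nat) (P : nat -> set F).
Hypothesis chainP : prime_chain l P.

(* The N^l independent monomials y^e with exponents below N live in the span of the
   monomials in x_0, ..., x_t of degree O(N). *)
Lemma chain_growth : exists C, forall N, (N ^ l <= (C * N).+1 ^ t.+1)%N.
Proof.
have [y yP] : {y : nat -> F & forall i, (i < l)%N -> P i.+1 (y i) /\ ~ P i (y i)}.
  apply: (boolp.choice (P := fun i x => (i < l)%N -> P i.+1 x /\ ~ P i x)) => i; have [lt_il|] := boolP (i < l)%N; last by exists 0.
  have [_ /existsNP[x /not_implyP xP]] := chainP.2 i lt_il.
  by exists x.
pose D := \max_(i < l) size (phi (y i)).
(* A product of powers of the y_j with exponents below N has degree at most l D N in the outer
   variable, and its coefficient of degree k involves only monomials of degree k d. *)
exists (l * D * d)%N => N; rewrite leqNgt; apply/negP => ltN.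
pose T := {ffun 'I_l -> 'I_N}.
pose C := {ffun 'I_t.+1 -> 'I_((l * D * d) * N).+1}.
pose emb (e : T) : {ffun 'I_l -> nat} := [ffun j => val (e j)].
pose col (f : C) : 'X_{1..n} := [multinom if insub (val i) is Some j then val (f j) else 0%N | i < n].
pose ym (e : T) := phi (chain_mon y 0 (emb e)).
(* One row for each product of the y_j, one column for each monomial in x_0, ..., x_t with exponents
   at most l D d N. A monomial of degree k d can only occur at the outer power k, recovered here by
   division. Independent rows contradict having more rows than columns. *)
pose M := \matrix_(i < #|T|, j < #|C|)
  ((ym (enum_val i))`_(mdeg (col (enum_val j)) %/ d))@_(col (enum_val j)).
suff : row_free M.
  rewrite -row_leq_rank => /leq_trans/(_ (rank_leq_col _)).
  by rewrite /T /C !card_ffun !card_ord leqNgt ltN.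
apply: inj_row_free => v vM.
have emb_inj : injective emb.
  by move=> e e' /ffunP ee'; apply/ffunP => j; apply: val_inj; have := ee' j; rewrite !ffunE.
pose c (e : T) := v 0 (enum_rank e).
suff c0 : forall e, c e = 0.
  by apply/rowP => i; rewrite mxE -[i]enum_valK [LHS]c0.
have [y_in y_notin] : (forall i, (i < l)%N -> P i.+1 (y i)) /\
    (forall i, (i < l)%N -> ~ P i (y i)) by split=> i /yP[].
apply: (chain_mon_free (iota := fiber_scalar K Ad) chainP y_in y_notin emb_inj).
apply: (@fiber_emb_inj K n d A Ad); rewrite -/phi raddf_sum raddf0.
apply/polyP => k; rewrite coef0 coef_sum; apply/mpolyP => m; rewrite mcoeff0 raddf_sum /=.
have phi_scalar x : phi (fiber_scalar K Ad x) = (x%:MP)%:P := fiber_emb_scalar Ad x.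
rewrite (eq_bigr (fun e => c e * ((ym e)`_k)@_m)); last first.
  by move=> e _; rewrite rmorphM /= phi_scalar coefCM mcoeffCM.
have [Am|nAm] := pselect (mset_mul A k m); last first.
  rewrite big1 // => e _; rewrite memN_msupp_eq0 ?mulr0 //.
  by apply/negP => em; apply: nAm; apply: fiber_emb_supp em.
have dm : mdeg m = (k * d)%N := mset_mul_mdeg Ad Am.
have ym_size e : (size (ym e) <= (l * D * N).+1)%N.
  rewrite /ym rmorph_prod /= (_ : l * D * N = \sum_(j < l) D * N)%N; last first.
    by rewrite sum_nat_const card_ord mulnA.
  apply: (big_ind2 (fun (p : {poly S}) b => size p <= b.+1)%N) => [|p b q b' pb qb'|j _].
  - by rewrite size_poly1.
  - apply: leq_trans (size_polyMleq _ _) _.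
    by lia.
  rewrite rmorphXn /=; apply: leq_trans (size_poly_exp_leq _ _) _; rewrite ltnS ffunE.
  apply: leq_mul; last exact/ltnW/ltn_ord.
  by apply: leq_trans (leq_pred _) _; apply: (leq_bigmax (F := fun i : 'I_l => size (phi (y i)))).
have [le_k|lt_k] := leqP k (l * D * N); last first.
  rewrite big1 // => e _; rewrite [(ym e)`_k]nth_default ?mcoeff0 ?mulr0 //.
  exact: leq_trans (ym_size e) _.
have mi i : (m i < (l * D * d * N).+1)%N.
  rewrite ltnS; apply: (@leq_trans (mdeg m)).
    by rewrite mdegE (bigD1 i) //= leq_addr.
  by rewrite dm mulnAC leq_mul2r le_k orbT.
pose f : C := [ffun j : 'I_t.+1 => Ordinal (mi (widen_ord (ltn_ord t) j))].
have mE : m = col f.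
  apply/mnmP => i; rewrite mnmE; case: insubP => [j lt_it ji|].
    by rewrite ffunE /=; congr (m _); apply: val_inj.
  by rewrite -leqNgt => /(mset_mul_support Am).
have := congr1 (fun w : 'rV_#|C| => w 0 (enum_rank f)) vM; rewrite !mxE => vM0.
rewrite -[RHS]vM0 (reindex (@enum_val T predT)) /=; last first.
  by exists enum_rank => e _; rewrite ?enum_valK ?enum_rankK.
apply: eq_bigr => i _; rewrite /c enum_valK mxE enum_rankK -mE; congr (_ * _`__ @_ _).
by rewrite dm mulnK.
Qed.

Lemma chain_length : (l <= t.+1)%N.
Proof.
rewrite leqNgt; apply/negP => lt_tl; have [C HC] := chain_growth.
(* Chosen above (C + 1)^(t+1), so that N^(t+2) exceeds (N (C + 1))^(t+1), which is at least (C N +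
   1)^(t+1). *)
pose N := (C.+1 ^ t.+1).+1.
have : (N ^ t.+2 <= N ^ t.+1 * C.+1 ^ t.+1)%N.
  apply: leq_trans (leq_pexp2l _ lt_tl) _ => //; apply: leq_trans (HC N) _.
  by rewrite -expnMn leq_exp2r // /N; lia.
by rewrite expnSr leq_pmul2l ?expn_gt0 // ltnn.
Qed.

End UpperBound.

(* Identify x_0, ..., x_(j-1) with x_t, and finally map all variables to 0. *)
Definition collapse_var (j : nat) (i : 'I_n) : S :=
  if (j <= t)%N then (if (i < j)%N then 'X_t else 'X_i) else 0.

Definition collapse (j : nat) : {rmorphism S -> S} := msubst (collapse_var j).

Lemma collapse_neq0 j m : (j <= t)%N -> collapse j 'X_[m] != 0.
Proof.
move=> le_jt; rewrite msubstX; apply/prodf_neq0 => i _; apply: expf_neq0.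
by rewrite /collapse_var le_jt; case: ifP => _; apply: mpolyX_neq0.
Qed.

Lemma collapseS j p : (j <= t)%N -> collapse j p = 0 -> collapse j.+1 p = 0.
Proof.
move=> le_jt pj0.
(* [collapse j.+1] factors through [collapse j]: it remains to send x_j to x_t or, when j = t, all
   variables to 0. *)
pose g : 'I_n -> S := fun i => if (j < t)%N then (if i == j :> nat then 'X_t else 'X_i) else 0.
suff -> : collapse j.+1 p = (msubst g \o collapse j) p by rewrite /= pj0 rmorph0.
apply: mpoly_rmorph_ext => [c|i]; rewrite [RHS]/= ?msubstC // !msubstXU.
rewrite /collapse_var le_jt.
have [lt_ij|ge_ij] := ltnP i j; rewrite msubstXU /g; case: ifP => // _.
  by rewrite ltnS (ltnW lt_ij) if_same.
by rewrite eqn_leq ge_ij andbT ltnS.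
Qed.

Hypothesis A0 : exists a, A a.
Hypothesis A_exchange : forall j : 'I_n, (j < t)%N -> exists a, exists b, exists i : 'I_n,
  [/\ A a, A b, (i < j)%N || (i == t) & (a + U_(i) = b + U_(j))%MM].

Let P (j : nat) : set F := [set x | (map_poly (collapse j) \o phi) x = 0].

(** Each collapse factors through the preceding one, so the kernels increase. At j = t a generator
    of the ideal is killed for the first time. For j < t, an exchange x_i x^a = x_j x^b gives x^a -
    x^b, which dies once x_j joins x_i at x_t, but not before. *)
Lemma collapse_chain : prime_chain t.+1 P.
Proof.
split=> [j _|j]; first exact: kernel_prime.
rewrite ltnS => le_jt; split.
  move=> x /= /polyP xj; apply/polyP => k; have := xj k.
  by rewrite (coef_map (collapse j)) (coef_map (collapse j.+1)) coef0; apply: collapseS.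
have PX x (p : S) j' : phi x = p *: 'X -> P j' x <-> collapse j' p = 0.
  move=> xp; rewrite /P /= xp; split=> [/polyP/(_ 1%N)|p0].
    by rewrite (coef_map (collapse j')) coefZ coefX mulr1 coef0.
  by apply/polyP => k; rewrite (coef_map (collapse j')) coefZ coef0 [LHS](rmorphM (collapse j')) /= p0 mul0r.
move=> subP; move: le_jt; rewrite leq_eqVlt => /predU1P[jt|lt_jt].
  have [a Aa] := A0; have [x /PX xa] := fiber_emb_gen K Ad Aa.
  have /subP/xa/eqP : P j.+1 x.
    apply/xa; rewrite msubstX /collapse_var jt ltnn.
    have [i ai] : exists i, a i != 0%N.
      apply/existsP; rewrite -negb_forall; apply/negP => /forallP a0.
      move: d_gt0; rewrite -(Ad Aa) (_ : a = 0%MM) ?mdeg0 //.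
      by apply/mnmP => i; rewrite mnm0E; apply/eqP.
    by rewrite (bigD1 i) //= expr0n (negPf ai) mul0r.
  by apply/negP/collapse_neq0; rewrite jt.
have [a [b [i [Aa Ab ij abE]]]] := A_exchange (j := Ordinal (ltn_trans lt_jt (ltn_ord t))) lt_jt.
set o := Ordinal _ in abE.
have [x xa] := fiber_emb_gen K Ad Aa; have [y yb] := fiber_emb_gen K Ad Ab.
have /PX xy : phi (x - y) = ('X_[a] - 'X_[b]) *: 'X by rewrite rmorphB scalerBl -xa -yb.
have abX j' : collapse j' 'X_[a] * collapse_var j' i = collapse j' 'X_[b] * collapse_var j' o.
  by rewrite -!msubstXU -!rmorphM -!mpolyXD abE.
have hi j' : (j <= j')%N -> (j' <= t)%N -> collapse_var j' i = 'X_t.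
  rewrite /collapse_var => le_j' ->; case/orP: ij => [/= lt_ij|/eqP ->].
    by rewrite (leq_trans lt_ij).
  by rewrite if_same.
have /subP/xy : P j.+1 (x - y).
  apply/xy; rewrite rmorphB; have := abX j.+1.
  rewrite hi ?leqnSn // /collapse_var lt_jt /= ltnSn => /mulIf -> //; rewrite ?subrr //.
  exact: mpolyX_neq0.
rewrite rmorphB => /eqP; rewrite subr_eq0 => /eqP abj; have := abX j.
rewrite hi ?(ltnW lt_jt) // /collapse_var (ltnW lt_jt) /= ltnn abj.
move/mulfI => /(_ (collapse_neq0 _ (ltnW lt_jt)))/mpolyP/(_ U_(t)%MM).
rewrite !mcoeffXU eqxx; case: eqP => [ot|_ /eqP]; last by rewrite oner_eq0.
by have := lt_jt; rewrite -[X in (_ < X)%N]/(val t) -ot ltnn.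
Qed.

Lemma mon_ideal_analytic_spread : analytic_spread I t.+1.
Proof.
split; first by exists P; apply: collapse_chain.
by move=> l Q; apply: chain_length.
Qed.

End AnalyticSpread.

(** * Freiman's inequality *)

Section SumsetSurplus.
Variable n : nat.
Local Notation mon := 'X_{1..n}.
Implicit Types (A B : {fset mon}) (L : mon -> int).

Definition sumset A : {fset mon} := [fset (a + b)%MM | a in A, b in A].

Definition mvec (m : mon) : 'rV[rat]_n := \row_i (m i)%:R.

(** For a nonempty set in one positive degree, the linear rank is the affine dimension D plus one;
    Freiman's bound (D + 1)|A| - D(D + 1)/2 then takes the form used in [surplus]. *)
Definition mrank A : nat := \dim <<[seq mvec a | a <- A]>>%VS.

Definition surplus A : int :=
  #|` sumset A|%:Z - (mrank A)%:Z * #|` A|%:Z + 'C(mrank A, 2)%:Z.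

Lemma sumsetP A m :
  reflect (exists a b, [/\ a \in A, b \in A & m = (a + b)%MM]) (m \in sumset A).
Proof.
apply: (iffP (imfset2P _ _ _ _ _)) => [[a aA [b bA ->]]|[a [b [aA bA ->]]]].
  by exists a, b.
by exists a => //; exists b.
Qed.

Lemma mem_sumset A a b : a \in A -> b \in A -> (a + b)%MM \in sumset A.
Proof. by move=> aA bA; apply/sumsetP; exists a, b. Qed.

Lemma mvecD a b : mvec (a + b)%MM = mvec a + mvec b.
Proof. by apply/rowP => i; rewrite !mxE mnmDE natrD. Qed.

Definition additive_weight L : Prop := forall a b, L (a + b)%MM = L a + L b.

(** Breaking ties by the monomial order gives a strict total order compatible with addition, so that
    a largest point is unique. *)
Definition wlt L (a b : mon) : bool :=
  (L a < L b) || (L a == L b) && (a < b)%O.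

Lemma wlt_irr L a : wlt L a a = false.
Proof. by rewrite /wlt !ltxx andbF. Qed.

Lemma wlt_trans L : transitive (wlt L).
Proof.
rewrite /wlt => b a c /orP[ab|/andP[/eqP ab ltab]] /orP[bc|/andP[/eqP bc ltbc]].
- by rewrite (lt_trans ab bc).
- by rewrite -bc ab.
- by rewrite ab bc.
- by rewrite ab bc eqxx (lt_trans ltab ltbc) orbT.
Qed.

Lemma wlt_total L a b : a != b -> wlt L a b || wlt L b a.
Proof. by rewrite /wlt; case: (ltgtP (L a) (L b)) => //= _; case: (ltgtP a b). Qed.

Lemma wlt_add L a b b' b'' : additive_weight L ->
  (b + a = b' + b'')%MM -> wlt L b'' a -> wlt L b b'.
Proof.
move=> LD E; have := congr1 L E; rewrite !LD /wlt => LE.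
case/orP => [lt_L|/andP[/eqP eL lt_m]]; first by rewrite (_ : L b < L b')%R //; lra.
have -> : L b = L b' by lra.
rewrite eqxx ltxx /= ltNge; apply/negP => le_b'b.
by have := lemc_lt_add le_b'b lt_m; rewrite E ltxx.
Qed.

Lemma wlt_max L A : A != fset0 ->
  exists2 a, a \in A & forall b, b \in A -> b != a -> wlt L b a.
Proof.
elim/finSet_rect: A => A IH /fset0Pn[a aA].
have [a1|/IH[|c]] := eqVneq (A `\ a) fset0.
- exists a => // b bA ba; have : b \in A `\ a by rewrite !inE ba.
  by rewrite a1.
- exact: fproperD1.
rewrite !inE => /andP[ca cA] cmax.
have [lt_ac|nlt_ac] := boolP (wlt L a c).
  exists c => // b bA bc; have [->//|ba] := eqVneq b a.
  by apply: cmax; rewrite // !inE ba.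
exists a => // b bA ba.
have ltca : wlt L c a by have := wlt_total L ca; rewrite (negPf nlt_ac) orbF.
have [->//|bc] := eqVneq b c.
by apply: wlt_trans ltca; apply: cmax; rewrite // !inE ba.
Qed.

(** * Removing the largest point of a finite set *)

Section RemoveMax.
Variables (A : {fset mon}) (L : mon -> int) (a : mon).
Hypotheses (LD : additive_weight L) (aA : a \in A).
Hypothesis amax : forall b, b \in A -> b != a -> wlt L b a.
Local Notation A' := (A `\ a).

Definition new_summands : {fset mon} := [fset b in A' | (b + a)%MM \notin sumset A'].

Lemma new_summandsE b :
  (b \in new_summands) = (b \in A') && ((b + a)%MM \notin sumset A').
Proof. by rewrite !inE. Qed.

Lemma rest_wlt b : b \in A' -> wlt L b a.
Proof. by rewrite !inE => /andP[ba bA]; apply: amax. Qed.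

(** Besides the sums b + a counted by [new_summands], the sum a + a is new, since a is larger than
    every other point. *)
Lemma sumset_remove : (#|` sumset A'| + #|` new_summands|.+1 <= #|` sumset A|)%N.
Proof.
pose B := [fset (b + a)%MM | b in a |` new_summands].
have card_B : #|` B| = #|` new_summands|.+1.
  rewrite card_imfset /=; last by move=> x y; apply: addIm.
  by rewrite cardfsU1 !inE eqxx.
have dis : [disjoint sumset A' & B].
  apply/fdisjointP => m /sumsetP[x [y [xA yA ->]]]; apply/negP => /imfsetP[b /=].
  rewrite !inE => /predU1P[->|].
    move=> E; have ltya := rest_wlt yA; have ltxa := rest_wlt xA.
    have := wlt_add LD (esym E) ltya => /wlt_trans/(_ ltxa).
    by rewrite wlt_irr.
  by move=> /andP[_ /negP nb] E; apply: nb; rewrite -E; apply: mem_sumset.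
rewrite -card_B -cardfsUI (_ : sumset A' `&` B = fset0); last by apply/eqP.
rewrite cardfs0 addn0; apply: fsubset_leq_card.
have A'A : A' `<=` A by apply: fsubD1set.
apply/fsubsetP => m; rewrite inE => /orP[/sumsetP[x [y [/(fsubsetP A'A) xA /(fsubsetP A'A) yA ->]]]|].
  exact: mem_sumset.
move=> /imfsetP[b /=]; rewrite !inE => /predU1P[->|/andP[/andP[_ bA] _]] ->; exact: mem_sumset.
Qed.

(* By the definition of [new_summands], any other difference b - a is the sum of two
   differences x - a and y - a, with x and y larger than b in the order. *)
Lemma new_summands_span b : b \in A' ->
  mvec b - mvec a \in <<[seq mvec x - mvec a | x <- new_summands]>>%VS.
Proof.
have [k] := ubnP #|` [fset x in A' | wlt L b x]|; elim: k b => // k IHk b.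
rewrite ltnS => le_k bA'; have [nb|] := boolP ((b + a)%MM \notin sumset A').
  by apply/memv_span/map_f; rewrite !inE nb andbT; move: bA'; rewrite !inE.
rewrite negbK => /sumsetP[x [y [xA yA E]]].
have larger x' y' : x' \in A' -> y' \in A' -> (b + a = x' + y')%MM ->
    mvec x' - mvec a \in <<[seq mvec x - mvec a | x <- new_summands]>>%VS.
  move=> x'A y'A E'; apply: IHk => //; apply: leq_trans le_k; apply: fproper_ltn_card.
  have ltbx : wlt L b x' := wlt_add LD E' (rest_wlt y'A).
  rewrite fproperE; apply/andP; split.
    by apply/fsubsetP => z; rewrite !inE => /andP[-> /(wlt_trans ltbx) ->].
  by apply/fsubsetPn; exists x'; rewrite !inE ?wlt_irr ?andbF // ltbx andbT; move: x'A; rewrite !inE.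
have -> : mvec b - mvec a = (mvec x - mvec a) + (mvec y - mvec a).
  have := congr1 mvec E; rewrite !mvecD => E'.
  by rewrite addrACA -E' addrA addrK.
apply: rpredD; first exact: (larger x y).
by apply: (larger y x); rewrite // E addmC.
Qed.

(** By [new_summands_span], the vector of a and the differences x - a over the new summands span
    everything. *)
Lemma mrank_remove : (mrank A <= #|` new_summands|.+1)%N.
Proof.
pose s := mvec a :: [seq mvec x - mvec a | x <- new_summands].
have -> : #|` new_summands|.+1 = size s by rewrite /s /= size_map.
apply: leq_trans (dim_span s); apply: dimvS; apply/span_subvP => _ /mapP[b bA ->].
have sa : mvec a \in <<s>>%VS by apply/memv_span/mem_head.
have [->//|ba] := eqVneq b a.
rewrite -(subrK (mvec a) (mvec b)) rpredD //.
have /new_summands_span : b \in A' by rewrite !inE ba.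
by apply/subvP/sub_span => z; rewrite inE orbC => ->.
Qed.

Lemma mrank_le_remove : (mrank A <= (mrank A').+1)%N.
Proof.
have -> : mrank A = \dim (<<[seq mvec x | x <- A']>> + <[mvec a]>)%VS.
  rewrite /mrank -span_seq1 -span_cat; congr (\dim _); apply: eq_span => v.
  rewrite mem_cat inE; apply/mapP/orP => [[b bA ->]|[/mapP[b]|/eqP ->]].
  - have [->|ba] := eqVneq b a; [by right|left].
    by apply: map_f; rewrite !inE ba.
  - by rewrite !inE => /andP[_ bA] ->; exists b.
  - by exists a.
apply: leq_trans (dimv_add_leqif _ _) _; rewrite dim_vline -/(mrank A').
by case: (_ != 0); rewrite ?addn1 ?addn0.
Qed.

(** An equality b + a = x + y with b, x, y in [A'] puts a = x + y - b into the span of [A'], and the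
    rank would not change. *)
Lemma new_summands_drop : mrank A != mrank A' -> new_summands = A'.
Proof.
move=> neq; apply/fsetP => b; rewrite new_summandsE; apply: andb_idr => bA'.
apply/negP => /sumsetP[x [y [xA yA /(congr1 mvec)]]]; rewrite !mvecD => E.
case/eqP: neq; congr (\dim _); apply/eqP; rewrite eqEsubv; apply/andP; split; last first.
  by apply: sub_span => _ /mapP[z zA ->]; apply: map_f; move: zA; rewrite !inE => /andP[].
apply/span_subvP => _ /mapP[z zA ->].
have A'v z' : z' \in A' -> mvec z' \in <<[seq mvec x | x <- A']>>%VS.
  by move=> z'A; apply/memv_span/map_f.
have [->|za] := eqVneq z a; last by apply: A'v; rewrite !inE za.
by rewrite -(addKr (mvec b) (mvec a)) E addrC rpredB ?rpredD // A'v.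
Qed.

(** If the rank r is unchanged, the bound grows by r, and at least r sums are new. If the rank rises
    from r to r + 1, the bound grows by (|A'| + r + 1) - r = |A'| + 1, and that many sums are
    new. *)
Lemma surplus_remove : surplus A' <= surplus A.
Proof.
have s1 := sumset_remove; have r1 := mrank_remove; have r2 := mrank_le_remove.
have cA : #|` A| = #|` A'|.+1 by rewrite (cardfsD1 a A) aA.
have bin2S k : 'C(k.+1, 2) = ('C(k, 2) + k)%N by rewrite binS bin1.
rewrite /surplus cA; have [rE|/[dup] /new_summands_drop nE ne] := eqVneq (mrank A) (mrank A').
  rewrite rE in r1 *; nia.
have {ne} rE : mrank A = (mrank A').+1.
  apply/eqP; rewrite eqn_leq r2 ltn_neqAle eq_sym ne /=; apply: dimvS; apply: sub_span.
  by move=> _ /mapP[z zA ->]; apply: map_f; move: zA; rewrite !inE => /andP[].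
rewrite nE in s1; rewrite rE bin2S; nia.
Qed.

End RemoveMax.

(** Take a weight that puts some point outside [A'] above all of [A']. The largest point of [A] in
    its order then lies outside [A'] as well, and can be removed; the separation hypothesis passes
    to what is left. *)
Lemma surplus_convex A A' : A' `<=` A ->
    (forall a, a \in A -> a \notin A' ->
      exists2 L, additive_weight L & forall b, b \in A' -> L b < L a) ->
  surplus A' <= surplus A.
Proof.
move=> A'A; elim/finSet_rect: A A'A => A IH A'A sep.
have [->//|] := eqVneq A' A; rewrite eqEfsubset A'A /= => /fsubsetPn[a0 a0A a0A'].
have [L LD La0] := sep _ a0A a0A'.
have A0 : A != fset0 by apply/fset0Pn; exists a0.
have [a aA amax] := wlt_max L A0.
have aA' : a \notin A'.
  apply/negP => /La0; have [->|ne] := eqVneq a0 a; first by rewrite ltxx.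
  have /orP[lt_a0a|/andP[/eqP -> _]] := amax _ a0A ne; last by rewrite ltxx.
  by move/(lt_trans lt_a0a); rewrite ltxx.
apply: le_trans (surplus_remove LD aA amax).
have A'Aa : A' `<=` A `\ a.
  by apply/fsubsetP => b bA'; rewrite !inE (fsubsetP A'A) // andbT; apply: contraNneq aA' => <-.
apply: IH => //; first exact: fproperD1.
by move=> b; rewrite !inE => /andP[_ bA]; apply: sep.
Qed.

(** Freiman's inequality: the empty set has surplus 0, and every point is separated from it. *)
Lemma surplus_ge0 A : 0 <= surplus A.
Proof.
have <- : surplus fset0 = 0.
  have s0 : sumset fset0 = fset0.
    by apply/fsetP => m; apply/sumsetP; rewrite in_fset0 => -[a [b []]].
  by rewrite /surplus s0 cardfs0 /mrank /= span_nil dimv0.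
apply: surplus_convex => [|a _ _]; first exact: fsub0set.
by exists (fun=> 0) => // x y; rewrite addr0.
Qed.

End SumsetSurplus.

(** * Principal Borel sets *)

Section BorelSets.
Variables (n b : nat).
Local Notation mon := 'X_{1..n}.
Implicit Types (u v w : mon).

Definition psum v (k : nat) : nat := \sum_(i < n | (i < k)%N) v i.

Definition borel_set u : set mon :=
  [set v | [/\ bounded b v, mdeg v = mdeg u & forall k, (psum u k <= psum v k)%N]].

Definition mmove v (j i : 'I_n) : mon := (v - U_(j) + U_(i))%MM.

Lemma mmoveE v j i k :
  mmove v j i k = (v k - (j == k) + (i == k))%N.
Proof. by rewrite mnmDE mnmBE !mnm1E. Qed.

Lemma mmove_add v j i : (0 < v j)%N -> (mmove v j i + U_(j) = v + U_(i))%MM.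
Proof.
move=> vj; apply/mnmP => k; rewrite !mnmDE mnmBE !mnm1E.
case: (j =P k) => [<-|_] /=; first by lia.
by rewrite addn0 subn0.
Qed.

Lemma psumD v w k : psum (v + w)%MM k = (psum v k + psum w k)%N.
Proof. by rewrite /psum -big_split; apply: eq_bigr => i _; rewrite mnmDE. Qed.

Lemma psum1 (i : 'I_n) k : psum U_(i)%MM k = (i < k)%N.
Proof.
rewrite /psum; under eq_bigr do rewrite mnm1E.
have [lt_ik|le_ki] := ltnP i k.
  rewrite (bigD1 i) //= eqxx big1 // => j /andP[_ ji].
  by rewrite eq_sym (negPf ji).
by rewrite big1 // => j lt_jk; case: eqP => // ij; move: lt_jk; rewrite -ij ltnNge le_ki.
Qed.

Lemma psum_mmove v j i k : (0 < v j)%N ->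
  (psum (mmove v j i) k + (j < k) = psum v k + (i < k))%N.
Proof. by move=> vj; have := congr1 (psum^~ k) (mmove_add i vj); rewrite /= !psumD !psum1. Qed.

Lemma mdeg_mmove v j i : (0 < v j)%N -> mdeg (mmove v j i) = mdeg v.
Proof.
by move=> vj; have := congr1 (@mdeg n) (mmove_add i vj); rewrite !mdegD !mdeg1 => /addIn.
Qed.

Lemma borel_set_refl u : bounded b u -> borel_set u u.
Proof. by split. Qed.

Lemma borel_set_trans u v w : borel_set u v -> borel_set v w -> borel_set u w.
Proof.
move=> [_ vd uv] [wb wd vw]; split=> //; first by rewrite wd.
by move=> k; apply: leq_trans (vw k).
Qed.

Lemma borel_set_move v (j i : 'I_n) : bounded b v -> (0 < v j)%N -> (v i < b)%N ->
  (i < j)%N -> borel_set v (mmove v j i).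
Proof.
move=> vb vj vi lt_ij; split.
- by move=> k; rewrite mmoveE; have := vb k; case: (i =P k) => [<-|_]; lia.
- exact: mdeg_mmove.
- move=> k; have := psum_mmove i k vj; have : (j < k -> i < k)%N by apply: ltn_trans.
  by case: (j < k)%N => [->|_]; lia.
Qed.

Lemma psum_recr v (i : 'I_n) : psum v i.+1 = (psum v i + v i)%N.
Proof.
rewrite /psum (bigD1 i) //= addnC; congr (_ + _)%N; apply: eq_bigl => j.
by rewrite ltnS ltn_neqAle andbC.
Qed.

(* Move from the first exponent where v is smaller than u to the first exponent
   where they differ. *)
Lemma borel_set_step u v : bounded b u -> borel_set u v -> v != u ->
  exists j i : 'I_n, [/\ (i < j)%N, (u i < v i)%N, (v j < u j)%N,
    bounded b (mmove u j i) & borel_set (mmove u j i) v].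
Proof.
move=> ub [vb vd uv] neq.
have [i0 ne_i0] : exists i, v i != u i.
  apply/existsP; rewrite -negb_forall; apply: contraNN neq => /forallP vu.
  by apply/eqP/mnmP => i; apply/eqP.
have [i ne_i min_i] := arg_minnP (fun i : 'I_n => val i) (ne_i0 : (fun i => v i != u i) i0).
have psi : psum u i = psum v i.
  apply: eq_bigr => j lt_ji; apply/esym/eqP; apply: contraTT lt_ji => /min_i.
  by rewrite -leqNgt.
have lt_i : (u i < v i)%N.
  by have := uv i.+1; rewrite !psum_recr psi leq_add2l ltn_neqAle eq_sym ne_i.
have [j0 lt_j0] : exists j, (v j < u j)%N.
  apply/existsP; rewrite -[X in is_true X]negbK negb_exists; apply/negP => /forallP ge.
  have : (mdeg u < mdeg v)%N; last by rewrite vd ltnn.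
  rewrite !mdegE (bigD1 i) // [X in (_ < X)%N](bigD1 i) //= -addSn leq_add //.
  by apply: leq_sum => j _; have := ge j; rewrite -leqNgt.
have [j lt_j min_j] := arg_minnP (fun i : 'I_n => val i) (lt_j0 : (fun i => v i < u i)%N j0).
have lt_ij : (i < j)%N.
  rewrite ltnNge leq_eqVlt; apply/negP => /orP[/eqP/val_inj ji|lt_ji].
    by move: lt_j lt_i; rewrite ji; lia.
  have : (i <= j)%N by apply: min_i; rewrite neq_ltn lt_j.
  by rewrite leqNgt lt_ji.
have uj : (0 < u j)%N by lia.
exists j, i; split=> //.
  by move=> k; rewrite mmoveE; have := ub k; case: (i =P k) => [<-|_]; have := vb i; lia.
split=> //; first by rewrite mdeg_mmove.
move=> k; have := psum_mmove i k uj; have := uv k.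
have [lt_jk|le_kj] := ltnP j k; have [lt_ik|le_ki] := ltnP i k; rewrite ?addn0 ?addn1; try lia.
(* For i < k <= j: below j the exponents of v are at least those of u, and strictly larger at i,
   which leaves room for the moved unit. *)
move=> _ ->; rewrite /psum (bigD1 i) // [X in (_ <= X)%N](bigD1 i) //= -addSn.
apply: leq_add => //; apply: leq_sum => l /andP[lt_lk _].
rewrite leqNgt; apply/negP => /min_j; rewrite leqNgt => /negP; apply.
exact: leq_trans lt_lk le_kj.
Qed.

Lemma finite_borel_set u : finite_set (borel_set u).
Proof.
apply: (@sub_finite_set _ _ [set val w | w in [set: 'X_{1..n < (mdeg u).+1}]]).
  move=> v [_ vd _] /=; have lt : (mdeg v < (mdeg u).+1)%N by rewrite vd.
  by exists (BMultinom lt).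
by apply: finite_image; apply: finite_finset.
Qed.

Definition borel_fset u : {fset mon} := fset_set (borel_set u).

Lemma borel_fsetP u v : reflect (borel_set u v) (v \in borel_fset u).
Proof.
rewrite in_fset_set; last exact: finite_borel_set.
by apply: (iffP idP) => [/set_mem|/mem_set].
Qed.

Variable K : fieldType.

Lemma borel_mon_ideal u : borel b (mon_ideal (K:=K) (borel_set u)).
Proof.
split; first by exists (borel_set u) => // v [].
move=> w wb /mon_idealX[v uv le_vw] i j wj lt_ij w' w'b; apply/mon_idealX.
(* If v has fewer factors x_j than w, it still divides w after the move. Otherwise both have the
   same number, and v is moved along with w. *)
have [lt_vw|ge_vw] := ltnP (v j) (w j).
  exists v => //; apply/mnm_lepP => k; rewrite /w' mmoveE; have := mnm_lepP le_vw k.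
  by case: (j =P k) => [<-|_] /=; lia.
have vj : v j = w j by apply/eqP; rewrite eqn_leq ge_vw (mnm_lepP le_vw).
have [vb _ _] := uv.
exists (mmove v j i).
  apply: borel_set_trans uv _; apply: borel_set_move; rewrite ?vj //.
  have := w'b i; rewrite mmoveE eqxx (negPf (_ : j != i)); last by rewrite -val_eqE gtn_eqF.
  by have := mnm_lepP le_vw i; lia.
apply/mnm_lepP => k; rewrite !mmoveE leq_add2r; apply: leq_sub2r; exact: mnm_lepP.
Qed.

Lemma borel_ideal_sub u (J : set {mpoly K[n]}) : bounded b u -> borel b J ->
  J 'X_[u] -> forall v, borel_set u v -> J 'X_[v].
Proof.
(* The total truncated excess of v over u drops with each move of [borel_set_step]. *)
move=> ub [_ Jmove] Ju v; have [k] := ubnP (\sum_i (v i - u i))%N.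
elim: k u ub Ju => // k IHk u ub Ju; rewrite ltnS => le_k uv.
have [->//|neq] := eqVneq v u.
have [j [i [lt_ij lt_i lt_j u'b u'v]]] := borel_set_step ub uv neq.
have uj : (0 < u j)%N by lia.
apply: (IHk (mmove u j i)) => //; first exact: Jmove.
apply: leq_trans le_k; rewrite (bigD1 i) // [X in (_ < X)%N](bigD1 i) //= -addSn.
apply: leq_add.
  by rewrite mmoveE eqxx (negPf (_ : j != i)) -?val_eqE ?gtn_eqF //; lia.
apply: leq_sum => l li; rewrite mmoveE [i == l]eq_sym (negPf li).
by case: (j =P l) => [<-|_]; lia.
Qed.

Lemma principal_borelE u : bounded b u ->
  principal_borel K b u = mon_ideal (K:=K) (borel_set u).
Proof.
move=> ub; apply/seteqP; split=> p.
  apply; split; first exact: borel_mon_ideal.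
  by move=> _ ->; apply: ideal_gen_incl; exists u => //; apply: borel_set_refl.
move=> Ip J [Jborel Ju]; move: Ip; apply: ideal_gen_min.
  by have [[A _ ->] _] := Jborel; apply: ideal_gen_ideal.
by move=> _ [v uv <-]; apply: borel_ideal_sub uv => //; apply: Ju.
Qed.

Lemma mu_principal_borel u : bounded b u ->
  mu (principal_borel K b u) = #|` borel_fset u|.
Proof.
move=> ub; rewrite /mu principal_borelE // (@mon_gens_equigenerated _ _ _ (mdeg u)) //.
by move=> v [].
Qed.

Lemma mu_principal_borel_sq u : bounded b u ->
  mu (ideal_exp (principal_borel K b u) 2) = #|` sumset (borel_fset u)|.
Proof.
move=> ub; rewrite /mu principal_borelE // mon_ideal_exp.
rewrite (@mon_gens_equigenerated _ _ _ (2 * mdeg u)); last first.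
  by apply: mset_mul_mdeg => v [].
rewrite mset_mul2; congr #|` _|; apply/fsetP => m.
suff E : madd (borel_set u) (borel_set u) = [set` sumset (borel_fset u)]%classic.
  by rewrite E set_fsetK.
apply/seteqP; split=> v /=.
  move=> [x /borel_fsetP xu [y /borel_fsetP yu ->]]; exact: mem_sumset.
by move=> /sumsetP[x [y [/borel_fsetP xu /borel_fsetP yu ->]]]; exists x => //; exists y.
Qed.

Lemma freiman_principal_borel u l : bounded b u ->
  analytic_spread (principal_borel K b u) l ->
  freiman (principal_borel K b u) <->
  #|` sumset (borel_fset u)|%:Z - l%:Z * #|` borel_fset u|%:Z + 'C(l, 2)%:Z = 0.
Proof.
move=> ub Il; rewrite /freiman mu_principal_borel_sq // mu_principal_borel //.
split=> [[_ _ [l' Il' ->]]|E].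
  suff -> : l' = l by lia.
  have [[[P chP] le_l] [[P' chP'] le_l']] := (Il, Il').
  by apply/eqP; rewrite eqn_leq (le_l _ _ chP') (le_l' _ _ chP).
split; first by exists (borel_set u); apply: principal_borelE.
  exists (mdeg u) => v; rewrite principal_borelE //.
  rewrite (@mon_gens_equigenerated _ _ _ (mdeg u)) => [[]//|w []//].
by exists l => //; lia.
Qed.

End BorelSets.

(** * Monomials that are not Freiman *)

Section ConvexSubsets.
Variable n : nat.
Local Notation mon := 'X_{1..n}.
Implicit Types (A B : {fset mon}) (m : mon).

(** The hull in dual form, by half-spaces. A point that fails it comes with a separating weight, as
    [surplus_convex] asks for. *)
Definition in_hull A m : Prop := forall L (c : int), additive_weight L ->
  (forall b, b \in A -> L b <= c) -> L m <= c.

Lemma surplus_hull A B : B `<=` A ->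
  (forall a, a \in A -> in_hull B a -> a \in B) -> surplus B <= surplus A.
Proof.
move=> BA hullB; apply: surplus_convex => // a aA aB.
have [//|nsep] := pselect (exists2 L, additive_weight L & forall b, b \in B -> L b < L a).
case/negP: aB; apply: hullB => // L c LD Bc; rewrite leNgt; apply/negP => lt_c.
by apply: nsep; exists L => // b /Bc /le_lt_trans; apply.
Qed.

Lemma in_hull_bounds A m (f : mon -> nat) (lo hi : nat) :
    (forall x y, f (x + y)%MM = (f x + f y)%N) -> in_hull A m ->
    (forall b, b \in A -> lo <= f b <= hi)%N ->
  (lo <= f m <= hi)%N.
Proof.
move=> fD hull bnd; apply/andP; split.
  suff : - (f m)%:Z <= - lo%:Z by lia.
  apply: (hull (fun x => - (f x)%:Z)) => [x y|b /bnd]; last by lia.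
  by rewrite fD; lia.
suff : (f m)%:Z <= hi%:Z by lia.
apply: (hull (fun x => (f x)%:Z)) => [x y|b /bnd]; last by lia.
by rewrite fD; lia.
Qed.

Lemma size_le_card (T : eqType) A (f : mon -> T) (s : seq T) : uniq s ->
  (forall y, y \in s -> exists2 m, m \in A & f m = y) -> (size s <= #|` A|)%N.
Proof.
move=> us sA; rewrite -(size_map f); apply: uniq_leq_size => // y /sA[m mA <-].
exact: map_f.
Qed.

Lemma mrank_le_size A (s : seq 'rV[rat]_n) :
  (forall a, a \in A -> mvec a \in <<s>>%VS) -> (mrank A <= size s)%N.
Proof.
move=> As; apply: leq_trans (dim_span s); apply: dimvS; apply/span_subvP.
by move=> _ /mapP[a aA ->]; apply: As.
Qed.

End ConvexSubsets.

Section BorelSurplus.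
Variables (n : nat) (u : 'X_{1..n}).
Local Notation mon := 'X_{1..n}.
Local Notation A := (borel_fset 2 u).
Implicit Types (m v : mon).

Lemma borel_fset_up x y (j i : 'I_n) : x \in A -> (y + U_(j) = x + U_(i))%MM ->
  (i < j)%N -> (y i <= 2)%N -> y \in A.
Proof.
move=> /borel_fsetP xA E lt_ij yi; have [xb _ _] := xA.
apply/borel_fsetP; apply: borel_set_trans xA _.
have Ek k : (y k + (j == k) = x k + (i == k))%N.
  by have := congr1 (fun m : mon => m k) E; rewrite !mnmDE !mnm1E.
have ji : (j == i) = false by rewrite -val_eqE gtn_eqF.
have xj : (0 < x j)%N by have := Ek j; rewrite eqxx [i == j]eq_sym ji /=; lia.
have -> : y = mmove x j i.
  apply/mnmP => k; rewrite mmoveE; have := Ek k.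
  by case: (j =P k) => [<-|_] /=; lia.
by apply: borel_set_move => //; have := Ek i; rewrite eqxx ji /=; lia.
Qed.

Lemma borel_fset_move (x y : mon) (j i : 'I_n) : x \in A ->
  (forall k, y k + (j == k) = x k + (i == k))%N -> (i < j)%N -> (y i <= 2)%N -> y \in A.
Proof.
move=> xA yE; apply: borel_fset_up xA _; apply/mnmP => k.
by rewrite !mnmDE !mnm1E.
Qed.

(* The six monomials [v x_i x_j / (x_s x_w)], with i and j distinct in {p, q, s, w},
   form an octahedron, with 19 > 4 * 6 - 6 sums. *)
Lemma borel_octahedron v (p q s w : 'I_n) : v \in A -> (p < q < s)%N -> (s < w)%N ->
  (v p < 2)%N -> (v q < 2)%N -> (0 < v s)%N -> (0 < v w)%N -> 0 < surplus A.
Proof.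
move=> vA /andP[lt_pq lt_qs] lt_sw vp vq vs vw.
pose z := (v - U_(s) - U_(w))%MM.
pose P := [:: p; q; s; w].
pose o (x : nat * nat) := (z + U_(nth p P x.1) + U_(nth p P x.2))%MM.
pose X := [:: (0, 1); (0, 2); (0, 3); (1, 2); (1, 3); (2, 3)]%N.
pose B : {fset mon} := [fset o x | x in X].
have zE i : (z i + (s == i) + (w == i) = v i)%N.
  rewrite !mnmBE !mnm1E; case: (s =P i) => [<-|_]; last by case: (w =P i) => [<-|_] /=; lia.
  by rewrite -val_eqE /=; lia.
have oE x i : o x i = (z i + (nth p P x.1 == i) + (nth p P x.2 == i))%N.
  by rewrite !mnmDE !mnm1E.
have uP : uniq P by rewrite /= !inE -!val_eqE /=; lia.
have X4 x : x \in X -> (x.1 < 4)%N /\ (x.2 < 4)%N.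
  by move=> xX; apply/andP; move: x xX; apply/allP.
have oat x l : x \in X -> (l < 4)%N ->
    o x (nth p P l) = (z (nth p P l) + (x.1 == l) + (x.2 == l))%N.
  by move=> /X4[x1 x2] l4; rewrite oE !nth_uniq.
have [zp zq] : (z p <= 1)%N /\ (z q <= 1)%N by have := zE p; have := zE q; lia.
have up := borel_fset_move.
(* The pair (2, 3) gives v itself. The moves to the other pairs raise exponents only at p and q,
   where v has room. *)
have o23 : o (2, 3)%N \in A.
  by rewrite (_ : o _ = v) //; apply/mnmP => i; rewrite oE /= zE.
have o13 : o (1, 3)%N \in A.
  by apply: (up _ _ s q o23) => [k| |]; rewrite ?oE -?val_eqE /=; clear -lt_pq lt_qs lt_sw zp zq; lia.
have o03 : o (0, 3)%N \in A.
  by apply: (up _ _ q p o13) => [k| |]; rewrite ?oE -?val_eqE /=; clear -lt_pq lt_qs lt_sw zp zq; lia.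
have o12 : o (1, 2)%N \in A.
  by apply: (up _ _ w q o23) => [k| |]; rewrite ?oE -?val_eqE /=; clear -lt_pq lt_qs lt_sw zp zq; lia.
have o02 : o (0, 2)%N \in A.
  by apply: (up _ _ q p o12) => [k| |]; rewrite ?oE -?val_eqE /=; clear -lt_pq lt_qs lt_sw zp zq; lia.
have o01 : o (0, 1)%N \in A.
  by apply: (up _ _ s q o02) => [k| |]; rewrite ?oE -?val_eqE /=; clear -lt_pq lt_qs lt_sw zp zq; lia.
have allB (Q : mon -> Prop) : (forall x, x \in X -> Q (o x)) -> forall b, b \in B -> Q b.
  by move=> QX b /imfsetP[x /= xX ->]; apply: QX.
have BA : B `<=` A.
  apply/fsubsetP; apply: allB => x; rewrite !inE.
  by do 5 (case/predU1P => [-> //|]); move/eqP->.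
(* The hull fixes the exponents outside of [P], confines those in [P] to z or z + 1, and fixes their
   total at two above that of z. The lattice points left are the six points of [B]. *)
have hullB a : a \in A -> in_hull B a -> a \in B.
{ move=> _ hB.
  have far i : i \notin P -> a i = z i.
    move=> iP; apply/eqP; rewrite eqn_leq andbC.
    apply: (in_hull_bounds (f := fun m => m i) _ hB) => [x y|]; first exact: mnmDE.
    apply: allB => x /X4[x1 x2]; rewrite oE.
    have neq k : (k < 4)%N -> (nth p P k == i) = false.
      by move=> k4; apply: contraNF iP => /eqP <-; apply: mem_nth.
    by rewrite !neq // !addn0 leqnn.
  have near l : (l < 4)%N -> (z (nth p P l) <= a (nth p P l) <= (z (nth p P l)).+1)%N.
    move=> l4; apply: (in_hull_bounds (f := fun m => m (nth p P l)) _ hB) => [x y|].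
      exact: mnmDE.
    apply: allB => x xX; rewrite oat //.
    have : x.1 != x.2 by move: x xX; apply/allP.
    by case: (x.1 =P l) => [->|_]; [move/negPf; rewrite eq_sym => -> | case: (_ == l)] => /=;
      rewrite ?addn0 ?addn1 !leqnn ?leqnSn.
  have tot : (z p + z q + z s + z w + 2 <= a p + a q + a s + a w <= z p + z q + z s + z w + 2)%N.
    apply: (in_hull_bounds (f := (fun m => m p + m q + m s + m w)%N) _ hB) => [x y|].
      by rewrite !mnmDE; clear; lia.
    apply: allB => x xX; rewrite -[X in (_ <= X <= _)%N]/(o x p + o x q + o x s + o x w)%N.
    have := (oat x 0 xX isT, oat x 1 xX isT, oat x 2 xX isT, oat x 3 xX isT)%N.
    have cnt k : (k < 4 -> (k == 0) + (k == 1) + (k == 2) + (k == 3) = 1)%N.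
      by case: k => [|[|[|[|]]]].
    move=> /= [[[-> ->] ->] ->]; have [/cnt + /cnt] := X4 _ xX.
    by case: x {xX} => x1 x2 /=; clear; lia.
  have {far} inB x : x \in X -> (forall l, (l < 4)%N -> a (nth p P l) = (z (nth p P l) + (x.1 == l) + (x.2 == l))%N) -> a \in B.
    move=> xX ax; apply/imfsetP; exists x => //=; apply/mnmP => i.
    have [/(nthP p)[l l4 <-]|iP] := boolP (i \in P); first by rewrite ax // oat.
    rewrite far // oE; have [x1 x2] := X4 _ xX.
    have neq k : (k < 4)%N -> (nth p P k == i) = false.
      by move=> k4; apply: contraNF iP => /eqP <-; apply: mem_nth.
    by rewrite !neq // !addn0.
  have /= n0 := near 0%N isT; have /= n1 := near 1%N isT.
  have /= n2 := near 2%N isT; have /= n3 := near 3%N isT.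
  have [e0|e0] : a p = z p \/ a p = (z p).+1 by clear -n0 n1 n2 n3; lia.
  all: have [e1|e1] : a q = z q \/ a q = (z q).+1 by clear -n0 n1 n2 n3; lia.
  all: have [e2|e2] : a s = z s \/ a s = (z s).+1 by clear -n0 n1 n2 n3; lia.
  all: have [e3|e3] : a w = z w \/ a w = (z w).+1 by clear -n0 n1 n2 n3; lia.
  all: try (exfalso; clear -tot e0 e1 e2 e3; lia).
  - by apply: (inB (2, 3)%N) => // -[|[|[|[|]]]] //= _; clear -e0 e1 e2 e3; lia.
  - by apply: (inB (1, 3)%N) => // -[|[|[|[|]]]] //= _; clear -e0 e1 e2 e3; lia.
  - by apply: (inB (1, 2)%N) => // -[|[|[|[|]]]] //= _; clear -e0 e1 e2 e3; lia.
  - by apply: (inB (0, 3)%N) => // -[|[|[|[|]]]] //= _; clear -e0 e1 e2 e3; lia.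
  - by apply: (inB (0, 2)%N) => // -[|[|[|[|]]]] //= _; clear -e0 e1 e2 e3; lia.
  - by apply: (inB (0, 1)%N) => // -[|[|[|[|]]]] //= _; clear -e0 e1 e2 e3; lia. }
have cB : (#|` B| <= 6)%N by apply: leq_trans (leq_imfset_card _ _ _) _.
have rB : (mrank B <= 4)%N.
  pose e (i : 'I_n) := mvec U_(i)%MM.
  pose G := [:: mvec z + e w + e w; e p - e w; e q - e w; e s - e w].
  apply: (@mrank_le_size _ _ G); apply: allB => x /X4[x1 x2].
  have eG k : (k < 4)%N -> e (nth p P k) - e w \in <<G>>%VS.
    case: k => [|[|[|[|//]]]] _ /=; last by rewrite subrr mem0v.
    - by apply: memv_span; rewrite !inE eqxx ?orbT.
    - by apply: memv_span; rewrite !inE eqxx ?orbT.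
    - by apply: memv_span; rewrite !inE eqxx ?orbT.
  have -> : mvec (o x) = (mvec z + e w + e w) + (e (nth p P x.1) - e w) + (e (nth p P x.2) - e w).
    by rewrite /o !mvecD -/(e _) -/(e _); apply/rowP => j; rewrite !mxE; ring.
  apply: rpredD; [apply: rpredD|]; try exact: eG.
  by apply: memv_span; apply: mem_head.
(* Less 2z, the sums are the vectors of {0, 1, 2}^4 with total 4: six of type 2200, twelve of type
   2110, and 1111. *)
have sB : (19 <= #|` sumset B|)%N.
  pose g (x y : nat * nat) l := ((x.1 == l) + (x.2 == l) + (y.1 == l) + (y.2 == l))%N.
  pose Y := undup [seq [seq g x y l | l <- iota 0 4] | x <- X, y <- X].
  apply: (@size_le_card _ _ _ (fun m => [seq (m (nth p P l) - z (nth p P l) - z (nth p P l))%N | l <- iota 0 4]) Y).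
    exact: undup_uniq.
  move=> _ /[!mem_undup] /allpairsP[[x y] [xX yX ->]].
  rewrite -[(x, y).1]/x -[(x, y).2]/y in xX yX *.
  exists (o x + o y)%MM; first by apply: mem_sumset; apply/imfsetP; [exists x|exists y].
  apply/eq_in_map => l; rewrite mem_iota add0n => /andP[_ l4].
  rewrite [X in (X - _ - _)%N]mnmDE !oat // /g.
  by case: x y {xX yX} => [x1 x2] [y1 y2] /=; clear; lia.
apply: lt_le_trans (surplus_hull BA hullB); rewrite /surplus.
have bE : [/\ 'C(0, 2) = 0, 'C(1, 2) = 0, 'C(2, 2) = 1, 'C(3, 2) = 3 & 'C(4, 2) = 6]%N by [].
case: bE => b0 b1 b2 b3 b4; clear -cB rB sB b0 b1 b2 b3 b4.
(* An upper bound for the rank suffices: 19 - 6 r + C(r, 2) is positive for every r <= 4. *)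
by case: (mrank B) rB => [|[|[|[|[|]]]]] // _; lia.
Qed.

End BorelSurplus.

Section BorelSegre.
Variables (n : nat) (u : 'X_{1..n}).
Local Notation mon := 'X_{1..n}.
Local Notation A := (borel_fset 2 u).

(* The nine monomials [v x_a x_y / (x_x x_w)] with x in {a, h, c} and y in
   {q, q', w} form a product of two triangles, with 36 > 5 * 9 - 10 sums. *)
Lemma borel_segre (v : mon) (a h c q q' w : 'I_n) : v \in A ->
  (a < h < c)%N -> (c <= q < q')%N -> (q' < w)%N ->
  (v a < 2)%N -> (0 < v h)%N -> (0 < v c)%N -> (v q < 2)%N -> (v q' < 2)%N -> (0 < v w)%N ->
  0 < surplus A.
Proof.
move=> vA /andP[lt_ah lt_hc] /andP[le_cq lt_qq'] lt_q'w va vh vc vq vq' vw.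
(* With b = v x_a / x_w, the points arise by replacing a factor from [P] by one from [Q] in b, and
   the pair (0, 2) gives back v. *)
pose b := mmove v w a.
have bE i : (b i + (w == i) = v i + (a == i))%N.
  by have := congr1 (fun m : mon => m i) (mmove_add a vw); rewrite !mnmDE !mnm1E.
pose P := [:: a; h; c]; pose Q := [:: q; q'; w].
pose X : seq (nat * nat) := [:: (0, 0); (0, 1); (0, 2); (1, 0); (1, 1); (1, 2);
  (2, 0); (2, 1); (2, 2)]%N.
pose o (x : nat * nat) := mmove b (nth a P x.1) (nth w Q x.2).
pose B : {fset mon} := [fset o x | x in X].
have uP : uniq P by rewrite /= !inE -!val_eqE /=; lia.
have uQ : uniq Q by rewrite /= !inE -!val_eqE /=; lia.
have X3 x : x \in X -> (x.1 < 3)%N /\ (x.2 < 3)%N.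
  by move=> xX; apply/andP; move: x xX; apply/allP.
have bP l : (l < 3)%N -> (0 < b (nth a P l))%N.
  case: l => [|[|[|//]]] _ /=.
  - by have := bE a; rewrite -val_eqE eqxx /=; clear -lt_ah lt_hc le_cq lt_qq' lt_q'w; lia.
  - by have := bE h; rewrite -!val_eqE /=; clear -vh lt_ah lt_hc le_cq lt_qq' lt_q'w; lia.
  - by have := bE c; rewrite -!val_eqE /=; clear -vc lt_ah lt_hc le_cq lt_qq' lt_q'w; lia.
have oE x i : x \in X -> (o x i + (nth a P x.1 == i) = b i + (nth w Q x.2 == i))%N.
  move=> /X3[x1 _]; have := congr1 (fun m : mon => m i) (mmove_add (nth w Q x.2) (bP _ x1)).
  by rewrite !mnmDE !mnm1E.
have up x y (j i : 'I_n) : x \in X -> y \in X -> o x \in A ->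
    (forall k, (nth w Q y.2 == k) + (nth a P x.1 == k) + (j == k) = (nth w Q x.2 == k) + (nth a P y.1 == k) + (i == k))%N ->
    (i < j)%N -> (o y i <= 2)%N -> o y \in A.
  move=> xX yX xA E; apply: borel_fset_move xA _ => k.
  by have := E k; have := oE x k xX; have := oE y k yX; clear; lia.
have o02 : o (0, 2)%N \in A.
  rewrite (_ : o _ = v) //; apply/mnmP => i.
  by have := oE (0, 2)%N i isT; have := bE i; rewrite /=; clear; lia.
have o01 : o (0, 1)%N \in A.
  apply: (up _ _ w q' _ _ o02) => // [k|]; first by rewrite /=; clear; lia.
  have := oE (0, 1)%N q' isT; have := bE q'; rewrite -!val_eqE /=.
  by clear -vq' lt_ah lt_hc le_cq lt_qq' lt_q'w; lia.
have o00 : o (0, 0)%N \in A.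
  apply: (up _ _ w q _ _ o02) => // [k||]; first by rewrite /=; clear; lia.
    by clear -lt_qq' lt_q'w; lia.
  have := oE (0, 0)%N q isT; have := bE q; rewrite -!val_eqE /=.
  by clear -vq lt_ah lt_hc le_cq lt_qq' lt_q'w; lia.
have ba : b a = (v a).+1.
  by have := bE a; rewrite -!val_eqE /=; clear -lt_ah lt_hc le_cq lt_qq' lt_q'w; lia.
have o1 y : (y < 3)%N -> o (0%N, y) \in A -> o (1%N, y) \in A.
  move=> y3 oA; have [yX yX'] : (0%N, y) \in X /\ (1%N, y) \in X.
    by case: y y3 {oA} => [|[|[|]]].
  apply: (up _ _ h a _ _ oA) => // [k|]; first by rewrite /=; clear; lia.
  have := oE (1%N, y) a yX'; rewrite ba /= -!val_eqE.
  have : (val (nth w Q y) == val a) = false.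
    by case: y y3 {oA yX yX'} => [|[|[|]]] //= _; clear -lt_ah lt_hc le_cq lt_qq' lt_q'w; lia.
  by move=> -> /=; clear -va lt_ah; lia.
have o2 y : (y < 3)%N -> o (0%N, y) \in A -> o (2%N, y) \in A.
  move=> y3 oA; have [yX yX'] : (0%N, y) \in X /\ (2%N, y) \in X.
    by case: y y3 {oA} => [|[|[|]]].
  apply: (up _ _ c a _ _ oA) => // [k||]; first by rewrite /=; clear; lia.
    by clear -lt_ah lt_hc; lia.
  have := oE (2%N, y) a yX'; rewrite ba /= -!val_eqE.
  have : (val (nth w Q y) == val a) = false.
    by case: y y3 {oA yX yX'} => [|[|[|]]] //= _; clear -lt_ah lt_hc le_cq lt_qq' lt_q'w; lia.
  by move=> -> /=; clear -va lt_ah lt_hc; lia.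
have allB (R : mon -> Prop) : (forall x, x \in X -> R (o x)) -> forall m, m \in B -> R m.
  by move=> RX m /imfsetP[x /= xX ->]; apply: RX.
have BA : B `<=` A.
  have o0 y : (y < 3)%N -> o (0%N, y) \in A by case: y => [|[|[|]]].
  apply/fsubsetP; apply: allB => -[i y] /X3[/= i3 y3].
  by case: i i3 => [|[|[|//]]] _; [apply: o0|apply: o1 (o0 _ _)|apply: o2 (o0 _ _)].
have crd x : x \in X -> [/\ o x a + (x.1 == 0) = b a, o x h + (x.1 == 1) = b h,
    o x q' = b q' + (x.2 == 1) & o x w = b w + (x.2 == 2)]%N.
  move=> xX; have [x1 x2] := X3 _ xX; have := (oE x a xX, oE x h xX, oE x q' xX, oE x w xX).
  clear -lt_ah lt_hc le_cq lt_qq' lt_q'w x1 x2; move: (o x) => ox; rewrite -!val_eqE.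
  case: x x1 x2 => i y /=; case: i => [|[|[|//]]] _; case: y => [|[|[|//]]] _ /= [[[E1 E2] E3] E4];
    by split; lia.
have hullB m : m \in A -> in_hull B m -> m \in B.
{ move=> _ hB.
  have far i : i \notin P -> i \notin Q -> m i = b i.
    move=> iP iQ; apply/eqP; rewrite eqn_leq andbC.
    apply: (in_hull_bounds (f := fun m => m i) _ hB) => [x y|]; first exact: mnmDE.
    apply: allB => x xX; have [x1 x2] := X3 _ xX; have := oE x i xX.
    have -> : (nth a P x.1 == i) = false by apply: contraNF iP => /eqP <-; apply: mem_nth.
    have -> : (nth w Q x.2 == i) = false by apply: contraNF iQ => /eqP <-; apply: mem_nth.
    by rewrite !addn0 => ->; rewrite leqnn.
  have bh : (0 < b h)%N := bP 1%N isT.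
  have bnd (f : mon -> nat) lo hi : (forall x y, f (x + y)%MM = (f x + f y)%N) ->
      (forall x, x \in X -> lo <= f (o x) <= hi)%N -> (lo <= f m <= hi)%N.
    by move=> fD fB; apply: (in_hull_bounds fD hB); apply: allB.
  have add2 (i j : 'I_n) (x y : mon) : ((x + y)%MM i + (x + y)%MM j = x i + x j + (y i + y j))%N.
    by rewrite !mnmDE; clear; lia.
  have na : (b a - 1 <= m a <= b a)%N.
    by apply: (bnd (fun m => m a)) => [x y|x /crd[+ _ _ _]]; [exact: mnmDE|clear; lia].
  have nh : (b h - 1 <= m h <= b h)%N.
    by apply: (bnd (fun m => m h)) => [x y|x /crd[_ + _ _]]; [exact: mnmDE|clear; lia].
  have nq' : (b q' <= m q' <= b q' + 1)%N.
    by apply: (bnd (fun m => m q')) => [x y|x /crd[_ _ + _]]; [exact: mnmDE|clear; lia].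
  have nw : (b w <= m w <= b w + 1)%N.
    by apply: (bnd (fun m => m w)) => [x y|x /crd[_ _ _ +]]; [exact: mnmDE|clear; lia].
  have nah : (b a + b h - 1 <= m a + m h <= b a + b h)%N.
    apply: (bnd (fun m => m a + m h)%N) => [x y|-[i y] /crd[/= + + _ _]]; [exact: add2|clear; lia].
  have nqw : (b q' + b w <= m q' + m w <= b q' + b w + 1)%N.
    apply: (bnd (fun m => m q' + m w)%N) => [x y|-[i y] /crd[/= _ _ + +]]; [exact: add2|clear; lia].
  have [i [i3 mi]] : exists i, (i < 3)%N /\ (m a + (i == 0) = b a /\ m h + (i == 1) = b h)%N.
    have [ea|ea] : m a = b a \/ (m a).+1 = b a by clear -na ba; lia.
      have [eh|eh] : m h = b h \/ (m h).+1 = b h by clear -nh bh; lia.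
        by exists 2%N; rewrite ea eh !addn0.
      by exists 1%N; rewrite ea addn0 addn1.
    by exists 0%N; rewrite addn0 addn1; split=> //; split=> //; clear -nah ea nh; lia.
  have [y [y3 my]] : exists y, (y < 3)%N /\ (m q' = b q' + (y == 1) /\ m w = b w + (y == 2))%N.
    have [eq'|eq'] : m q' = b q' \/ m q' = (b q').+1 by clear -nq'; lia.
      have [ew|ew] : m w = b w \/ m w = (b w).+1 by clear -nw; lia.
        by exists 0%N; rewrite eq' ew !addn0.
      by exists 2%N; rewrite eq' ew addn0 addn1.
    by exists 1%N; rewrite addn0 addn1; split=> //; split=> //; clear -nqw eq' nw; lia.
  have xX : (i, y) \in X by case: i i3 {mi} => [|[|[|//]]] _; case: y y3 {my} => [|[|[|//]]].
  have [/= oa oh oq' ow] := crd _ xX.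
  suff [mc mq] : m c = o (i, y) c /\ m q = o (i, y) q.
    apply/imfsetP; exists (i, y) => //=; apply/mnmP => k.
    have [kP|kP] := boolP (k \in P).
      move: kP; rewrite !inE => /or3P[] /eqP ->; last exact: mc.
        by clear -mi oa; lia.
      by clear -mi oh; lia.
    have [kQ|kQ] := boolP (k \in Q).
      move: kQ; rewrite !inE => /or3P[] /eqP ->; first exact: mq.
        by clear -my oq'; lia.
      by clear -my ow; lia.
    have := oE _ k xX; rewrite far //=.
    have -> : (nth a P i == k) = false by apply: contraNF kP => /eqP <-; apply: mem_nth.
    have -> : (nth w Q y == k) = false by apply: contraNF kQ => /eqP <-; apply: mem_nth.
    by rewrite !addn0.
  (* The exponents at c and q follow from totals. If c = q, the triangles share this coordinate and
     the total over all five variables determines it; otherwise each triangle has a total of its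
     own. *)
  have [Ecq|neq_cq] := eqVneq c q.
    have oc x : x \in X -> (o x c + (x.1 == 2) = b c + (x.2 == 0))%N.
      move=> zX; have [x1 x2] := X3 _ zX; have := oE x c zX; subst q.
      clear -lt_ah lt_hc le_cq lt_qq' lt_q'w x1 x2; move: (o x) => ox; rewrite -!val_eqE.
      case: x x1 x2 => i y /=; case: i => [|[|[|//]]] _; case: y => [|[|[|//]]] _ /= E1;
        by lia.
    rewrite -Ecq; suff: m c = o (i, y) c by [].
    have tot : (b a + b h + b c + b q' + b w <= m a + m h + m c + m q' + m w <= b a + b h + b c + b q' + b w)%N.
      apply: (bnd (fun m => m a + m h + m c + m q' + m w)%N) => [x z|x zX].
        by rewrite !mnmDE; clear; lia.
      have [+ + + +] := crd x zX; have := oc x zX; have [] := X3 _ zX.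
      by move: (o x); case: x {zX} => x1 x2 ox /=; clear; lia.
    by have := oc _ xX; clear -tot mi my i3 y3 => /=; lia.
  have oc x : x \in X -> (o x c + (x.1 == 2) = b c)%N.
    move=> zX; have [x1 x2] := X3 _ zX; have := oE x c zX; move: neq_cq.
    clear -lt_ah lt_hc le_cq lt_qq' lt_q'w x1 x2; move: (o x) => ox; rewrite -!val_eqE.
    case: x x1 x2 => i y /=; case: i => [|[|[|//]]] _; case: y => [|[|[|//]]] _ /= ne E1;
      by lia.
  have oq x : x \in X -> (o x q = b q + (x.2 == 0))%N.
    move=> zX; have [x1 x2] := X3 _ zX; have := oE x q zX; move: neq_cq.
    clear -lt_ah lt_hc le_cq lt_qq' lt_q'w x1 x2; move: (o x) => ox; rewrite -!val_eqE.
    case: x x1 x2 => i y /=; case: i => [|[|[|//]]] _; case: y => [|[|[|//]]] _ /= ne E1;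
      by lia.
  have totP : (b a + b h + b c - 1 <= m a + m h + m c <= b a + b h + b c - 1)%N.
    apply: (bnd (fun m => m a + m h + m c)%N) => [x z|x zX].
      by rewrite !mnmDE; clear; lia.
    have [+ + _ _] := crd x zX; have := oc x zX; have [] := X3 _ zX.
    by move: (o x); case: x {zX} => x1 x2 ox /=; clear; lia.
  have totQ : (b q + b q' + b w + 1 <= m q + m q' + m w <= b q + b q' + b w + 1)%N.
    apply: (bnd (fun m => m q + m q' + m w)%N) => [x z|x zX].
      by rewrite !mnmDE; clear; lia.
    have [_ _ + +] := crd x zX; have := oq x zX; have [] := X3 _ zX.
    by move: (o x); case: x {zX} => x1 x2 ox /=; clear; lia.
  have bc : (0 < b c)%N := bP 2%N isT.
  split; first by have := oc _ xX; clear -totP mi i3 bc => /=; lia.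
  by have := oq _ xX; clear -totQ my y3 => /=; lia. }
have cB : (#|` B| <= 9)%N by apply: leq_trans (leq_imfset_card _ _ _) _.
have rB : (mrank B <= 5)%N.
  pose e (i : 'I_n) := mvec U_(i)%MM.
  pose G := [:: mvec b - e a + e w; e a - e h; e a - e c; e q - e w; e q' - e w].
  apply: (@mrank_le_size _ _ G); apply: allB => x xX; have [x1 x2] := X3 _ xX.
  have GP k : (k < 3)%N -> e a - e (nth a P k) \in <<G>>%VS.
    case: k => [|[|[|//]]] _ /=; first by rewrite subrr mem0v.
    - by apply: memv_span; rewrite !inE eqxx ?orbT.
    - by apply: memv_span; rewrite !inE eqxx ?orbT.
  have GQ k : (k < 3)%N -> e (nth w Q k) - e w \in <<G>>%VS.
    case: k => [|[|[|//]]] _ /=; last by rewrite subrr mem0v.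
    - by apply: memv_span; rewrite !inE eqxx ?orbT.
    - by apply: memv_span; rewrite !inE eqxx ?orbT.
  have -> : mvec (o x) = (mvec b - e a + e w) + (e a - e (nth a P x.1)) + (e (nth w Q x.2) - e w).
    have := congr1 (@mvec n) (mmove_add (nth w Q x.2) (bP _ x1)); rewrite !mvecD -/(e _) -/(e _) => E.
    apply: (addIr (e (nth a P x.1))); rewrite E; apply/rowP => j; rewrite !mxE; ring.
  apply: rpredD; [apply: rpredD|]; [|exact: GP|exact: GQ].
  by apply: memv_span; apply: mem_head.
have sB : (36 <= #|` sumset B|)%N.
  (* Two coordinates of each triangle identify a sum. A triangle has 6 sums of two vertices, and all
     6 . 6 combinations occur. *)
  pose g (x y : nat * nat) := [:: (x.1 == 0) + (y.1 == 0); (x.1 == 1) + (y.1 == 1);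
    (x.2 == 1) + (y.2 == 1); (x.2 == 2) + (y.2 == 2)]%N.
  pose Y := undup [seq g x y | x <- X, y <- X].
  apply: (@size_le_card _ _ _ (fun m => [:: b a + b a - m a; b h + b h - m h;
     m q' - b q' - b q'; m w - b w - b w]%N) Y); first exact: undup_uniq.
  move=> _ /[!mem_undup] /allpairsP[[x y] [xX yX ->]].
  rewrite -[(x, y).1]/x -[(x, y).2]/y in xX yX *.
  exists (o x + o y)%MM; first by apply: mem_sumset; apply/imfsetP; [exists x|exists y].
  have [xa xh xq xw] := crd x xX; have [ya yh yq yw] := crd y yX.
  rewrite !(mnmDE _ (o x) (o y)) /g.
  move: (o x) (o y) xa xh xq xw ya yh yq yw => ox oy; case: x {xX} => x1 x2; case: y {yX} => y1 y2 /=.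
  by clear => *; do 4 (congr (_ :: _); first by lia).
apply: lt_le_trans (surplus_hull BA hullB); rewrite /surplus.
have bin : [/\ 'C(0, 2) = 0, 'C(1, 2) = 0, 'C(2, 2) = 1, 'C(3, 2) = 3 & 'C(4, 2) = 6]%N by [].
have b5 : 'C(5, 2) = 10%N by [].
case: bin => b0 b1 b2 b3 b4; clear -cB rB sB b0 b1 b2 b3 b4 b5.
(* Again 36 - 9 r + C(r, 2) is positive for every r <= 5. *)
by case: (mrank B) rB => [|[|[|[|[|[|]]]]]] // _; lia.
Qed.

End BorelSegre.

Lemma psum_support n (v : 'X_{1..n}) (t : 'I_n) :
  (forall i : 'I_n, (t < i)%N -> v i = 0%N) -> psum v t.+1 = mdeg v.
Proof.
move=> v0; rewrite mdegE [RHS](bigID (fun j : 'I_n => j < t.+1)%N) /=.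
by rewrite [X in (_ + X)%N]big1 ?addn0 // => j; rewrite -leqNgt => /v0.
Qed.

(** * Rank, analytic spread and positive surplus of a Borel set *)

Section BorelGenerator.
Variables (n : nat) (u : 'X_{1..n}) (a t : 'I_n).
Local Notation mon := 'X_{1..n}.
Local Notation A := (borel_fset 2 u).
Hypotheses (ub : bounded 2 u) (a0 : val a = 0%N) (ua : (u a <= 1)%N).
Hypotheses (ut : (0 < u t)%N) (ut0 : forall i : 'I_n, (t < i)%N -> u i = 0%N).
Hypothesis a_lt_t : (a < t)%N.

(** The partial sum of u up to t is already the full degree, so domination leaves nothing for v
    beyond t. *)
Lemma borel_set_support v (i : 'I_n) : borel_set 2 u v -> (t < i)%N -> v i = 0%N.
Proof.
move=> [_ vd uv] lt_ti; have := uv t.+1.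
rewrite (psum_support ut0) -vd mdegE [leqLHS](bigID (fun j : 'I_n => j < t.+1)%N) /= -/(psum v t.+1).
by rewrite [X in (_ + X <= _)%N](bigD1 i) -?leqNgt //=; clear; lia.
Qed.

Lemma mem_u : u \in A.
Proof. exact/borel_fsetP/borel_set_refl. Qed.

Lemma borel_move_t (j : 'I_n) : (j < t)%N -> (u j <= 1)%N -> borel_set 2 u (mmove u t j).
Proof. by move=> lt_jt uj; apply: borel_set_move. Qed.

Lemma borel_move_a (j : 'I_n) : (a < j)%N -> (0 < u j)%N -> borel_set 2 u (mmove u j a).
Proof. by move=> lt_aj uj; apply: borel_set_move. Qed.

(** The exchanges: if x_j has exponent at most 1, a factor x_t becomes x_j; if it has exponent 2,
    then j differs from a because [u a <= 1], and a factor x_j becomes x_a. *)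
Lemma borel_analytic_spread (K : fieldType) :
  analytic_spread (mon_ideal (K:=K) (borel_set 2 u)) t.+1.
Proof.
apply: (@mon_ideal_analytic_spread K n (mdeg u)).
- by rewrite mdegE (bigD1 t) //= ltn_addr.
- by move=> v [].
- by move=> v i; apply: borel_set_support.
- by exists u; apply: borel_set_refl.
move=> j lt_jt; have [uj|uj] := leqP (u j) 1.
  exists (mmove u t j), u, t; rewrite eqxx orbT.
  by split; [exact: borel_move_t|exact: borel_set_refl| |exact: mmove_add].
have lt_aj : (a < j)%N.
  by rewrite a0 lt0n -a0; apply/eqP => /val_inj ja; move: uj; rewrite ja ltnNge ua.
have uj0 : (0 < u j)%N by apply: ltnW.
exists u, (mmove u j a), a; rewrite lt_aj.
by split; [exact: borel_set_refl|exact: borel_move_a| |rewrite mmove_add].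
Qed.

Lemma mvec_sum (m : mon) : mvec m = \sum_i (m i)%:R *: mvec U_(i)%MM.
Proof.
apply/rowP => j; rewrite summxE !mxE (bigD1 j) //= !mxE mnm1E eqxx mulr1 big1 ?addr0 //.
by move=> i ij; rewrite !mxE mnm1E (negPf ij) mulr0.
Qed.

(** The exchanges put every e_j - e_t with j <= t into the span, and u itself then yields e_t. *)
Lemma mrank_borel : mrank A = t.+1.
Proof.
pose e (i : 'I_n) := mvec U_(i)%MM; pose W := <<[seq mvec m | m <- A]>>%VS.
have memW m : borel_set 2 u m -> mvec m \in W by move/borel_fsetP => mA; apply/memv_span/map_f.
have moveW (i j : 'I_n) : (0 < u j)%N -> borel_set 2 u (mmove u j i) -> e i - e j \in W.
  move=> uj /memW mW; have := congr1 (@mvec n) (mmove_add i uj).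
  rewrite [LHS]mvecD [RHS]mvecD -/(e _) -/(e _) => E.
  have -> : e i - e j = mvec (mmove u j i) - mvec u.
    by apply/eqP; rewrite subr_eq addrAC eq_sym subr_eq E addrC.
  by apply: rpredB => //; apply/memW/borel_set_refl.
have diffW (j : 'I_n) : (j <= t)%N -> e j - e t \in W.
  rewrite leq_eqVlt => /predU1P[/val_inj ->|lt_jt]; first by rewrite subrr mem0v.
  have [uj|uj] := leqP (u j) 1; first by apply: moveW => //; apply: borel_move_t.
  have lt_aj : (a < j)%N.
    by rewrite a0 lt0n -a0; apply/eqP => /val_inj ja; move: uj; rewrite ja ltnNge ua.
  have -> : e j - e t = (e a - e t) - (e a - e j) by rewrite [RHS]addrC opprB [RHS]addrA subrK.
  apply: rpredB; first by apply: moveW => //; apply: borel_move_t.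
  by apply: moveW; [apply: ltnW|apply: borel_move_a => //; apply: ltnW].
have etW : e t \in W.
  (* Since u is the sum of the u_i e_i, subtracting the u_i (e_i - e_t) leaves deg(u) e_t, and the
     nonzero degree is inverted in the rationals. *)
  have dE : (mdeg u)%:R *: e t = mvec u - \sum_i (u i)%:R *: (e i - e t).
    rewrite [mvec u]mvec_sum -sumrB mdegE natr_sum scaler_suml.
    by apply: eq_bigr => i _; rewrite -scalerBr opprB addrC subrK.
  have du : (mdeg u)%:R != 0 :> rat.
    by rewrite pnatr_eq0 mdegE (bigD1 t) //= -lt0n ltn_addr.
  rewrite -(scalerK du (e t)) dE rpredZ // rpredB //; first exact/memW/borel_set_refl.
  apply: rpred_sum => i _; have [le_it|lt_ti] := leqP i t; first by rewrite rpredZ ?diffW.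
  by rewrite ut0 // scale0r mem0v.
have eW (j : 'I_n) : (j <= t)%N -> e j \in W.
  by move=> /diffW ejW; rewrite -(subrK (e t) (e j)) rpredD.
apply/eqP; rewrite eqn_leq; apply/andP; split.
  pose s := [seq e (widen_ord (ltn_ord t) i) | i <- enum 'I_t.+1].
  have <- : size s = t.+1 by rewrite size_map size_enum_ord.
  apply: mrank_le_size => m /borel_fsetP mA; rewrite mvec_sum; apply: rpred_sum => i _.
  have [le_it|/(borel_set_support mA) ->] := leqP i t; last by rewrite scale0r mem0v.
  apply/rpredZ/memv_span/mapP; exists (Ordinal (le_it : (i < t.+1)%N)); rewrite ?mem_enum //.
(* The n - t - 1 unit vectors beyond t complete the span to the whole space, which bounds its
   dimension from below. *)
pose s := [seq e i | i : 'I_n <- enum 'I_n & (t < i)%N].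
have sz : (size s <= n - t.+1)%N.
  rewrite size_map size_filter -(count_map val (fun i => (t < i)%N)) val_enum_ord.
  rewrite -[n in iota 0 n](subnKC (ltn_ord t)) iotaD count_cat.
  rewrite [X in (X + _)%N](_ : _ = 0%N); last first.
    apply/eqP; rewrite -leqn0 leqNgt -has_count; apply/hasPn => i.
    by rewrite mem_iota add0n => /andP[_]; rewrite ltnS -leqNgt.
  by apply: leq_trans (count_size _ _) _; rewrite size_iota.
have full : (W + <<s>>)%VS = fullv.
  apply/eqP; rewrite eqEsubv subvf; apply/subvP => v _.
  have -> : v = \sum_i v 0 i *: e i.
    apply/rowP => j; rewrite summxE (bigD1 j) //= !mxE mnm1E eqxx mulr1 big1 ?addr0 //.
    by move=> i ij; rewrite !mxE mnm1E (negPf ij) mulr0.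
  apply: rpred_sum => i _; apply: rpredZ; have [le_it|lt_ti] := leqP i t.
    by apply: (subvP (addvSl _ _)); apply: eW.
  apply: (subvP (addvSr _ _)); apply/memv_span/map_f.
  by rewrite mem_filter lt_ti mem_enum.
have := dimv_add_leqif W <<s>>%VS; rewrite full dimvf => -[le_n _].
have := leq_trans le_n (leq_add (leqnn _) (leq_trans (dim_span s) sz)).
by rewrite dim_matrix mul1r -/(mrank A); have := ltn_ord t; clear; lia.
Qed.

(** Exponents are at most 2, so a total of 3 needs two places. *)
Lemma two_positive (lo hi : nat) : (3 <= \sum_(i < n | lo <= i < hi) u i)%N ->
  exists h s : 'I_n, [/\ (lo <= h < s)%N, (s < hi)%N, (0 < u h)%N & (0 < u s)%N].
Proof.
move=> sum3.
have [i /andP[iP ui]] : exists i : 'I_n, ((lo <= i < hi) && (0 < u i))%N.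
  apply/existsP; rewrite -[X in is_true X]negbK negb_exists; apply/negP => /forallP none.
  move: sum3; rewrite big1 // => i iP; have := none i; rewrite iP /= -leqNgt leqn0.
  by move/eqP.
have [j /and3P[jP ji uj]] : exists j : 'I_n, [&& (lo <= j < hi)%N, j != i & (0 < u j)%N].
  apply/existsP; rewrite -[X in is_true X]negbK negb_exists; apply/negP => /forallP none.
  move: sum3; rewrite (bigD1 i) //= big1 ?addn0 => [|j /andP[jP ji]].
    by have := ub i; clear; lia.
  by have := none j; rewrite jP ji /= -leqNgt leqn0 => /eqP.
have [lt_ij|lt_ji|/val_inj eij] := ltngtP i j.
- by exists i, j; split=> //; move: iP jP; clear -lt_ij; lia.
- by exists j, i; split=> //; move: iP jP; clear -lt_ji; lia.
- by rewrite eij eqxx in ji.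
Qed.

(** Indices start at 0, so r = t + 1; the exponents at t - 1 and t are left free. *)
Definition freiman_shape : Prop :=
  u a = 1%N /\ forall i : 'I_n, (0 < i)%N -> (i.+1 < t)%N -> u i = 2%N.

Lemma mdeg_split : mdeg u = (u a + \sum_(i < n | 1 <= i < t) u i + u t)%N.
Proof.
rewrite mdegE (bigID (fun i : 'I_n => i <= t)%N) /= [X in (_ + X)%N]big1 ?addn0; last first.
  by move=> i; rewrite -ltnNge => /ut0.
rewrite (bigD1 a) ?(ltnW a_lt_t) //= -addnA; congr (_ + _)%N.
rewrite (bigD1 t) /=; last by rewrite leqnn -val_eqE neq_ltn a_lt_t orbT.
rewrite addnC; congr (_ + _)%N; apply: eq_bigl => i; rewrite -!val_eqE /= a0.
by clear; lia.
Qed.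

Lemma surplus_borel_gt0 : (5 <= mdeg u)%N -> ~ freiman_shape -> 0 < surplus A.
Proof.
move=> d5 nshape.
have [ua0|ua1] : u a = 0%N \/ u a = 1%N by clear -ua; lia.
  (* Without x_1, a total of at least 5 - 2 = 3 lies strictly between a and t, hence two places h <
     s. Moving a factor from h to a leaves room at both a and h for an octahedron. *)
  have [|h [s [/andP[h1 lt_hs] lt_st uh us]]] := @two_positive 1 t.
    by have := mdeg_split; have := ub t; clear -d5 ua0; lia.
  have lt_ah : (a < h)%N by rewrite a0.
  have hE i : (mmove u h a i = u i - (h == i) + (a == i))%N by rewrite mmoveE.
  have /borel_fsetP vA := borel_move_a lt_ah uh.
  apply: (borel_octahedron (p := a) (q := h) (s := s) (w := t) vA); rewrite ?lt_ah ?hE -?val_eqE //=.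
  - by clear -ua0 lt_ah; lia.
  - by have := ub h; clear -lt_ah; lia.
  - by clear -lt_hs lt_ah us; lia.
  - by clear -lt_hs lt_ah lt_st ut; lia.
have [q [q0 lt_qt uq]] : exists q : 'I_n, [/\ (0 < q)%N, (q.+1 < t)%N & (u q <= 1)%N].
  have [//|none] := pselect (exists q : 'I_n, [/\ (0 < q)%N, (q.+1 < t)%N & (u q <= 1)%N]).
  case: nshape; split=> // i i0 lt_it; apply/eqP; rewrite eqn_leq ub /= ltnNge.
  by apply/negP => ui; apply: none; exists i.
have lt_aq : (a < q)%N by rewrite a0.
have lt_tn := ltn_ord t.
have octa (s : 'I_n) v : v \in A -> (q < s)%N -> (s < t)%N -> (v a <= 1)%N -> (v q <= 1)%N ->
    (0 < v s)%N -> (0 < v t)%N -> 0 < surplus A.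
  by move=> vA qs st va vq vs vt; apply: (borel_octahedron (p := a) (q := q) vA _ st); rewrite ?lt_aq.
(* A variable of u strictly between q and t gives an octahedron at once; from here on u vanishes
   there. *)
have [[s [lt_qs lt_st us]]|none] := pselect (exists s : 'I_n, [/\ (q < s)%N, (s < t)%N & (0 < u s)%N]).
  exact: (octa s u mem_u).
have u0 (s : 'I_n) : (q < s)%N -> (s < t)%N -> u s = 0%N.
  move=> lt_qs lt_st; apply/eqP; rewrite -leqn0 leqNgt; apply/negP => us.
  by apply: none; exists s.
have lt_q1n : (q.+1 < n)%N by apply: ltn_trans lt_qt lt_tn.
pose q' := Ordinal lt_q1n.
have uq' : u q' = 0%N by apply: u0.
have [ut1|ut2] : u t = 1%N \/ u t = 2%N by have := ub t; clear -ut; lia.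
  (* With exponent 1 at a and at t, a total of at least 3 lies in the range from 1 to q. It provides
     h < c <= q for a product of triangles, whose other triangle is q, q + 1, t. *)
  have [|h [c [/andP[h1 lt_hc] lt_cq uh uc]]] := @two_positive 1 q.+1.
    have -> : (\sum_(i < n | 1 <= i < q.+1) u i = \sum_(i < n | 1 <= i < t) u i)%N.
      rewrite [RHS](bigID (fun i : 'I_n => i < q.+1)%N) /= [X in (_ + X)%N]big1 ?addn0.
        by apply: eq_bigl => i; clear -lt_qt; lia.
      by move=> i /andP[/andP[_ lt_it]]; rewrite -leqNgt => lt_qi; apply: u0.
    by have := mdeg_split; rewrite ua1 ut1; clear -d5; lia.
  apply: (borel_segre (v := u) (a := a) (h := h) (c := c) (q := q) (q' := q') (w := t)) => //.
  - exact: mem_u.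
  - by rewrite a0 h1.
  - by rewrite /= ltnSn andbT -ltnS.
  - by rewrite uq'.
have lt_q't : (q' < t)%N by [].
have [t' t'E] : exists t' : 'I_n, (t' : nat) = t.-1.
  by exists (Ordinal (leq_ltn_trans (leq_pred t) lt_tn)).
have lt_qt' : (q < t')%N by rewrite t'E; clear -lt_qt; lia.
have lt_t't : (t' < t)%N by rewrite t'E; clear -lt_qt; lia.
have ut' : u t' = 0%N by apply: u0.
(* Splitting x_t^2 into x_(t-1) x_t provides the two positive places that the octahedron needs
   beyond q. *)
have /borel_fsetP vA : borel_set 2 u (mmove u t t') by apply: borel_move_t; rewrite ?ut'.
apply: (octa t' _ vA) => //; rewrite mmoveE -!val_eqE /= ?ut' ?ut2 ?ua1.
- by clear -lt_aq lt_qt' lt_t't; lia.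
- by clear -uq lt_qt' lt_t't; lia.
- by clear -lt_t't; lia.
- by clear -lt_t't; lia.
Qed.

End BorelGenerator.

(** * Monomials that are Freiman *)

(* Pairs of exponents (x, y) with sum e of the last two variables of a monomial. *)
Definition tails (y_max e : nat) : seq (nat * nat) :=
  [seq xy <- [seq (x, y) | x <- iota 0 3, y <- iota 0 3] | (xy.1 + xy.2 == e) && (xy.2 <= y_max)]%N.

Definition tail_sums (X X' : seq (nat * nat)) : seq (nat * nat) :=
  undup [seq (p.1 + q.1, p.2 + q.2)%N | p <- X, q <- X'].

Lemma mem_tails y_max e x y : ((x, y) \in tails y_max e) =
  [&& x <= 2, y <= 2, x + y == e & y <= y_max]%N.
Proof.
have memL : ((x, y) \in [seq (i, j) | i <- iota 0 3, j <- iota 0 3]) = (x <= 2)%N && (y <= 2)%N.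
  by case: x => [|[|[|x]]]; case: y => [|[|[|y]]].
by rewrite mem_filter memL andbC -!andbA.
Qed.

(** Here x and y are the exponents of the last two variables of u, and s + 2 is the rank. The left
    side will bound |A + A| plus the binomial, the right side is the rank times a lower bound for
    |A|. Six pairs (x, y) remain, each an inequality between polynomials in s. *)
Lemma tails_count (x y s : nat) : (x <= 2)%N -> (0 < y <= 2)%N ->
  ('C(s.+1, 2) * size (tail_sums (tails y (x + y)) (tails y (x + y))) +
   s * size (tail_sums (tails y (x + y)) (tails y (x + y).-1)) +
   size (tail_sums (tails y (x + y).-1) (tails y (x + y).-1)) + 'C(s.+2, 2) <=
   s.+2 * (s * size (tails y (x + y)) + size (tails y (x + y).-1)))%N.
Proof.
have := mul_bin_diag s.+1 1; have := mul_bin_diag s.+2 1.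
rewrite /= !bin1; move: ('C(s.+1, 2)) ('C(s.+2, 2)) => c1 c2 E2 E1.
case: x => [|[|[|//]]] _; case: y => [|[|[|//]]] //= _; rewrite ?muln1; clear -E1 E2; nia.
Qed.

Section FreimanShape.
Variables (n : nat) (u : 'X_{1..n}) (a t : 'I_n).
Local Notation mon := 'X_{1..n}.
Local Notation A := (borel_fset 2 u).
Hypotheses (ub : bounded 2 u) (a0 : val a = 0%N).
Hypotheses (ut : (0 < u t)%N) (ut0 : forall i : 'I_n, (t < i)%N -> u i = 0%N).
Hypotheses (t2 : (2 <= t)%N) (ushape : freiman_shape u a t).

Let s := t.-1.

Let tE : (t : nat) = s.+1.
Proof. by rewrite /s prednK // ltnW. Qed.

Let s_gt0 : (0 < s)%N.
Proof. by move: t2; rewrite tE. Qed.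

Let t'_ltn : (s < n)%N.
Proof. by apply: ltn_trans (ltn_ord t); rewrite tE. Qed.

Let t' : 'I_n := Ordinal t'_ltn.

Let ua : u a = 1%N. Proof. by case: ushape. Qed.

Let a_lt_t : (a < t)%N. Proof. by rewrite a0 ltnW. Qed.

(* The exponents of x_0, ..., x_(s-1) are 2, except for a 1 at place l if l < s; taking
   l = s leaves them all equal to 2. *)
Let word (l x y : nat) : mon := [multinom
  (if (k < s)%N then 2 - (k == l :> nat) else if k == s :> nat then x else
   if k == t :> nat then y else 0)%N | k < n].

(** The shape of a sum of two words. It is symmetric in l and l', which is why unordered pairs
    suffice in the count of A + A. *)
Let word2 (l l' x y : nat) : mon := [multinom
  (if (k < s)%N then 4 - (k == l :> nat) - (k == l' :> nat) else if k == s :> nat then x else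
   if k == t :> nat then y else 0)%N | k < n].

Let word_sum l l' x y x' y' :
  (word l x y + word l' x' y')%MM = word2 l l' (x + x') (y + y').
Proof.
apply/mnmP => k; rewrite mnmDE !mnmE; case: ifP => // _; first by do 2 case: (_ == _).
by do 2 (case: ifP => // _).
Qed.

Let word2C l l' x y : word2 l l' x y = word2 l' l x y.
Proof. by apply/mnmP => k; rewrite !mnmE -!subnDA [(((k : nat) == l) + _)%N]addnC. Qed.

(** [X1] holds the tails of words with one lowered exponent (l < s); without one, the tail has one
    factor less, as in [X0]. *)
Let X1 := tails (u t) (u t' + u t).
Let X0 := tails (u t) (u t' + u t).-1.

Let word_u : word 0 (u t') (u t) = u.
Proof.
apply/mnmP => k; rewrite mnmE; case: ltnP => [lt_ks|le_sk].
  case: eqP => [k0|/eqP k0]; first by rewrite (_ : k = a) ?ua //; apply: val_inj; rewrite /= k0.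
  by have [_ ->] := ushape; rewrite ?subn0 ?lt0n // tE ltnS.
case: eqP => [ks|/eqP ks]; first by congr (u _); apply: val_inj.
case: eqP => [kt|/eqP kt]; first by congr (u _); apply: val_inj.
by rewrite ut0 // tE; move: ks kt le_sk; rewrite tE; clear; lia.
Qed.

Let word_tail l x y : (x < 2)%N -> word l x y.+1 \in A -> word l x.+1 y \in A.
Proof.
move=> x2 wA; apply: (borel_fset_move (j := t) (i := t') wA) => [k||].
- rewrite !mnmE -!val_eqE /= tE; clear; do ?case: ifP; lia.
- by rewrite tE.
- by rewrite mnmE /= ltnn eqxx.
Qed.

Let word_letter l x y : (l < s)%N -> word 0 x y \in A -> word l x y \in A.
Proof.
move=> lt_ls wA; have [->//|l0] := eqVneq l 0%N.
have lt_ln : (l < n)%N := ltn_trans lt_ls t'_ltn.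
apply: (borel_fset_move (j := Ordinal lt_ln) (i := a) wA) => [k||].
- rewrite !mnmE -!val_eqE /= a0 tE; clear -l0 lt_ls; do ?case: ifP; lia.
- by rewrite a0 lt0n.
- by rewrite mnmE a0 s_gt0; clear; lia.
Qed.

Let word_top1 x y : word 0 x.+1 y \in A -> word s x y \in A.
Proof.
move=> wA; apply: (borel_fset_move (j := t') (i := a) wA) => [k||].
- rewrite !mnmE -!val_eqE /= a0 tE; move: s_gt0; clear; do ?case: ifP; lia.
- by rewrite a0.
- by rewrite mnmE a0 s_gt0; clear; lia.
Qed.

Let word_top2 x y : word 0 x y.+1 \in A -> word s x y \in A.
Proof.
move=> wA; apply: (borel_fset_move (j := t) (i := a) wA) => [k||].
- rewrite !mnmE -!val_eqE /= a0 tE; move: s_gt0; clear; do ?case: ifP; lia.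
- by rewrite a0 tE.
- by rewrite mnmE a0 s_gt0; clear; lia.
Qed.

Let word_X1 l x y : (l < s)%N -> (x, y) \in X1 -> word l x y \in A.
Proof.
move=> lt_ls; rewrite mem_tails => /and4P[x2 y2 /eqP xyE y_le]; apply: word_letter => //.
have [k] := ubnP (u t - y)%N; elim: k x y x2 y2 xyE y_le => // k IHk x y x2 y2 xyE y_le le_k.
have [yt|yt] := eqVneq y (u t).
  have xt : x = u t' by move: xyE; rewrite yt; clear; lia.
  by rewrite xt yt word_u; apply: mem_u.
have lt_y : (y < u t)%N by rewrite ltn_neqAle yt.
case: x x2 xyE => [_ xyE|x x2 xyE]; first by move: xyE lt_y; clear; lia.
apply: word_tail => //; apply: IHk => //.
- exact: ltnW.
- by apply: leq_trans lt_y _; apply: ub.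
- by rewrite -xyE addSnnS.
- by move: le_k lt_y; clear; lia.
Qed.

Let word_X0 x y : (x, y) \in X0 -> word s x y \in A.
Proof.
rewrite mem_tails => /and4P[x2 y2 /eqP xyE y_le].
have [lt_x2|ge_x2] := ltnP x 2.
  apply/word_top1/word_X1 => //; rewrite mem_tails lt_x2 y2 y_le andbT /= addSn xyE.
  by rewrite prednK // addn_gt0 ut orbT.
have xE : x = 2%N by apply/eqP; rewrite eqn_leq x2.
have := ub t'; have := ub t => t2' t'2.
(* With x = 2 the extra factor is restored at x_t: from 2 + y = p + q - 1 and p <= 2 it follows that
   y + 1 <= q. *)
apply/word_top2/word_X1 => //; rewrite mem_tails; move: xyE t2' t'2 ut; rewrite xE; clear; lia.
Qed.

Lemma psum_freiman_shape : (psum u s + 1 = \sum_(i < n | (i < s)%N) 2)%N.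
Proof.
rewrite /psum (bigD1 a) ?a0 //= [RHS](bigD1 a) ?a0 //= ua addnAC; congr (_ + _)%N.
apply: eq_bigr => i /andP[lt_is ia]; have [_ ->] := ushape => //; last by rewrite tE.
by rewrite lt0n -a0; apply: contraNneq ia => E; apply/eqP/val_inj.
Qed.

Let psum_top (v : mon) : (forall i : 'I_n, (t < i)%N -> v i = 0%N) ->
  (mdeg v = psum v s + v t' + v t)%N.
Proof.
move=> v0; rewrite -(psum_support v0) psum_recr tE.
by rewrite -[psum v s.+1]/(psum v t'.+1) psum_recr.
Qed.

Let mem_word (v : mon) : v \in A -> exists l x y,
  ((l < s)%N /\ (x, y) \in X1 \/ l = s /\ (x, y) \in X0) /\ v = word l x y.
Proof.
move=> /borel_fsetP vA; have [vb vd uv] := vA.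
have v0 (i : 'I_n) (lt_ti : (t < i)%N) : v i = 0%N := borel_set_support ut0 vA lt_ti.
have topv := psum_top v0; have topu := psum_top ut0.
have Esplit : (\sum_(i < n | (i < s)%N) (2 - v i) + psum v s = psum u s + 1)%N.
  rewrite psum_freiman_shape /psum -big_split; apply: eq_bigr => i _ /=.
  by rewrite subnK.
have ps := uv s; have ps1 := uv s.+1.
have := psum_recr v t'; have := psum_recr u t'; rewrite [val t']/= => pu pv.
rewrite -/s in pu pv; rewrite pu pv in ps1.
have tail l x y (k : 'I_n) : (s <= k)%N -> x = v t' -> y = v t -> word l x y k = v k.
  move=> le_sk -> ->; rewrite mnmE ltnNge le_sk /=.
  case: eqP => [ks|/eqP ks]; first by congr (v _); apply: val_inj.
  case: eqP => [kt|/eqP kt]; first by congr (v _); apply: val_inj.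
  by rewrite v0 // tE; move: ks kt le_sk; rewrite tE; clear; lia.
have vt2 := vb t; have vt'2 := vb t'.
have [d0|d1] : (\sum_(i < n | (i < s)%N) (2 - v i) = 0 \/ \sum_(i < n | (i < s)%N) (2 - v i) = 1)%N.
  by move: Esplit ps; clear; lia.
- exists s, (v t'), (v t); split.
    right; split=> //; rewrite mem_tails vt2 vt'2 /=.
    by move: topv topu vd ps1 Esplit ut; rewrite d0; clear; lia.
  apply/mnmP => k; have [lt_ks|le_sk] := ltnP k s; last by rewrite tail.
  rewrite mnmE lt_ks; have /eqP := d0; rewrite sum_nat_eq0 => /forallP/(_ k).
  by rewrite lt_ks /=; have := vb k; move: lt_ks; clear; lia.
have [i lt_is vi] : exists2 i : 'I_n, (i < s)%N & (0 < 2 - v i)%N.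
  have [//|none] := pselect (exists2 i : 'I_n, (i < s)%N & (0 < 2 - v i)%N).
  move: d1; rewrite big1 // => i lt_is; apply/eqP; rewrite -leqn0 leqNgt; apply/negP => vi.
  by apply: none; exists i.
move: (d1); rewrite (bigD1 i) //=; set S := (X in (_ + X)%N) => d1i.
exists i, (v t'), (v t); split.
  left; split=> //; rewrite mem_tails vt2 vt'2 /=.
  by move: topv topu vd ps1 Esplit ut; rewrite d1; clear; lia.
apply/mnmP => k; have [lt_ks|le_sk] := ltnP k s; last by rewrite tail.
rewrite mnmE lt_ks; have [->|ki] := eqVneq k i; first by rewrite eqxx /=; move: d1i vi (vb i); clear; lia.
have /eqP : S = 0%N by move: d1i vi; move: S; clear; lia.
rewrite sum_nat_eq0 => /forallP/(_ k); rewrite lt_ks ki /= => vk.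
by move: ki; rewrite -val_eqE => /negPf -> /=; move: vk (vb k); clear; lia.
Qed.

Let word_inj l l' x y x' y' : (l <= s)%N -> (l' <= s)%N ->
  word l x y = word l' x' y' -> [/\ l = l', x = x' & y = y'].
Proof.
move=> le_l le_l' E; have Ek k := congr1 (fun m : mon => m k) E.
have xx' : x = x' by have := Ek t'; rewrite !mnmE /= ltnn eqxx.
have yy' : y = y'.
  by have := Ek t; rewrite !mnmE eqxx tE ltnNge leqnSn /= gtn_eqF.
split=> //; have letter p (lt_ps : (p < s)%N) : (p == l) = (p == l').
  have := Ek (Ordinal (ltn_trans lt_ps t'_ltn)); rewrite !mnmE /= lt_ps.
  by do 2 case: (_ == _).
have [lt_l|ge_l] := ltnP l s.
  by have := letter l lt_l; rewrite eqxx => /esym/eqP.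
have [lt_l'|ge_l'] := ltnP l' s.
  by have := letter l' lt_l'; rewrite eqxx => /eqP.
by apply/eqP; rewrite eqn_leq (leq_trans le_l) // (leq_trans le_l').
Qed.

Let card_ge : (s * size X1 + size X0 <= #|` A|)%N.
Proof.
pose W := [seq word l xy.1 xy.2 | l <- iota 0 s, xy <- X1] ++ [seq word s xy.1 xy.2 | xy <- X0].
have uX e : uniq (tails (u t) e) by apply: filter_uniq.
have <- : size W = (s * size X1 + size X0)%N.
  by rewrite size_cat size_map size_allpairs size_iota.
apply: uniq_leq_size => [|m].
  rewrite cat_uniq; apply/and3P; split.
  - apply: allpairs_uniq; rewrite ?iota_uniq ?uX // => -[l [x y]] [l' [x' y']].
    move=> /allpairsP[[l1 xy1] /= [+ _ [-> _]]] /allpairsP[[l2 xy2] /= [+ _ [-> _]]].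
    rewrite !mem_iota !add0n => /andP[_ /ltnW l1s] /andP[_ /ltnW l2s] /= /word_inj.
    by case=> // -> -> ->.
  - apply/hasPn => _ /mapP[[x y] _ ->]; apply/negP => /allpairsP[[l1 [x1 y1]] /= [+ _]].
    rewrite mem_iota add0n => /andP[_ lt_ls] /word_inj[] //; first exact: ltnW.
    by move=> sl; rewrite sl ltnn in lt_ls.
  - rewrite map_inj_in_uniq ?uX // => -[x y] [x' y'] _ _ /= /word_inj[] // _ -> ->.
    by [].
rewrite mem_cat => /orP[/allpairsP[[l [x y]] /= [+ xyX ->]]|/mapP[[x y] xyX ->]].
  by rewrite mem_iota => /andP[_ lt_ls]; apply: word_X1.
exact: word_X0.
Qed.

Let card_sum_le : (#|` sumset A| <= 'C(s.+1, 2) * size (tail_sums X1 X1) +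
  s * size (tail_sums X1 X0) + size (tail_sums X0 X0))%N.
Proof.
(* The pairs i <= j < s, of which there are C(s + 1, 2). *)
pose L := [seq (i, j) | j <- iota 0 s, i <- iota 0 j.+1].
pose W := [seq word2 l.1 l.2 xy.1 xy.2 | l <- L, xy <- tail_sums X1 X1] ++
  [seq word2 l s xy.1 xy.2 | l <- iota 0 s, xy <- tail_sums X1 X0] ++
  [seq word2 s s xy.1 xy.2 | xy <- tail_sums X0 X0].
have sL : size L = 'C(s.+1, 2).
  rewrite -bin2_sum big_nat_recl // add0n size_allpairs_dep sumnE big_map.
  by rewrite /index_iota subn0; apply: eq_bigr => i _; rewrite size_iota.
have sW : size W = ('C(s.+1, 2) * size (tail_sums X1 X1) +
    s * size (tail_sums X1 X0) + size (tail_sums X0 X0))%N.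
  by rewrite !size_cat size_map !size_allpairs sL size_iota addnA.
rewrite -sW; apply: uniq_leq_size => [|m]; first exact: fset_uniq.
have sumsP X X' x y x' y' : (x, y) \in X -> (x', y') \in X' ->
    (x + x', y + y')%N \in tail_sums X X'.
  by move=> xX xX'; rewrite mem_undup; apply/allpairsP; exists ((x, y), (x', y')).
have memL l l' : (l <= l' < s)%N -> (l, l') \in L.
  move=> /andP[le_l lt_l']; apply/allpairsPdep; exists l', l.
  by rewrite !mem_iota /= !add0n ltnS.
move=> /sumsetP[v [v' [/mem_word[l [x [y [Hl ->]]]] /mem_word[l' [x' [y' [Hl' ->]]]] ->]]].
rewrite word_sum !mem_cat; case: Hl => -[lS xX]; case: Hl' => -[lS' xX'].
- apply/orP; left; have [le_ll'|lt_l'l] := leqP l l'.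
    by apply/allpairsP; exists ((l, l'), (x + x', y + y')%N); rewrite memL ?le_ll' // sumsP.
  rewrite word2C (addnC x) (addnC y); apply/allpairsP.
  exists ((l', l), (x' + x, y' + y)%N); split=> /=; [|exact: sumsP|by []].
  by rewrite memL // ltnW.
- rewrite lS'; apply/orP; right; apply/orP; left; apply/allpairsP.
  by exists (l, (x + x', y + y')%N); rewrite mem_iota sumsP.
- rewrite lS word2C (addnC x) (addnC y); apply/orP; right; apply/orP; left; apply/allpairsP.
  by exists (l', (x' + x, y' + y)%N); rewrite mem_iota sumsP.
rewrite lS lS'; do 2 (apply/orP; right).
by apply/mapP; exists (x + x', y + y')%N; rewrite ?sumsP.
Qed.

Lemma mdeg_freiman_shape (k : 'I_n) : k = t.-1 :> nat ->
  ((mdeg u).+1 = 2 * t.-1 + u k + u t)%N.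
Proof.
move=> kE; have -> : k = t' by apply: val_inj.
have := psum_top ut0; have := psum_freiman_shape.
rewrite -(big_ord_widen n (fun=> 2)) ?(ltnW t'_ltn) // sum_nat_const card_ord -/s.
by move: (psum u s) (u t') => p q; clear; lia.
Qed.

(** By [surplus_ge0] only one inequality is left, so [card_ge] and [card_sum_le] need not be
    equalities. *)
Lemma surplus_freiman_shape : surplus A = 0.
Proof.
apply/eqP; rewrite eq_le surplus_ge0 andbT /surplus.
rewrite (mrank_borel ub a0 _ ut ut0 a_lt_t) ?ua // tE.
have count := tails_count s (ub t') (introT andP (conj ut (ub t))).
have H : (#|` sumset A| + 'C(s.+2, 2) <= s.+2 * #|` A|)%N.
  apply: leq_trans (leq_mul (leqnn s.+2) card_ge).
  by apply: leq_trans (leq_add card_sum_le (leqnn _)) _; apply: count.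
by rewrite -PoszM; move: ('C(_, _)) (s.+2 * _)%N #|` _| H; clear; lia.
Qed.

End FreimanShape.

(** * The classification *)

Section ListedMonomials.
Variables (K : fieldType) (n : nat).
Local Notation S := {mpoly K[n]}.
Local Notation x := (@xvar K n).

Lemma xvar_ord (i : 'I_n) : x i.+1 = 'X_i.
Proof.
rewrite /xvar (bigD1 i) //= big1 ?addr0 // => j /andP[/eqP[ji] /eqP]; case.
exact: val_inj.
Qed.

Lemma xvar_out i : (n < i)%N -> x i = 0.
Proof.
move=> lt_ni; rewrite /xvar big1 // => j /eqP ji; have := ltn_ord j.
by rewrite -ltnS ji ltnNge lt_ni.
Qed.

Lemma mpolyX_inj : injective (fun m : 'X_{1..n} => 'X_[m] : S).
Proof.
move=> m m' E; have := mcoeffX K m m'; rewrite E mcoeffX eqxx.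
by case: eqP => // _ /eqP; rewrite oner_eq0.
Qed.

Lemma prod_xvar (E : nat -> nat) N : (N <= n.+1)%N ->
  \prod_(1 <= i < N) x i ^+ E i =
  'X_[[multinom (if (i.+1 < N)%N then E i.+1 else 0%N) | i < n]].
Proof.
case: N => [|N] le_Nn.
  by rewrite big_geq // -mpolyX0; congr 'X_[_].
rewrite big_add1 big_mkord (big_ord_widen n (fun i => x i.+1 ^+ E i.+1)) //=.
rewrite mpolyXE_id [LHS]big_mkcond; apply: eq_bigr => i _; rewrite mnmE ltnS.
by case: ifP => _; rewrite ?expr0 // xvar_ord.
Qed.

(** A common form for the six products of the theorem, with r equal to m + 1 or m + 2. *)
Definition listed_form (r p q : nat) : S :=
  x 1%N * (\prod_(2 <= i < r.-1) x i ^+ 2) * x r.-1 ^+ p * x r ^+ q.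

Variables (u : 'X_{1..n}) (a t t' : 'I_n).
Hypotheses (a0 : val a = 0%N) (ut : (0 < u t)%N).
Hypotheses (ut0 : forall i : 'I_n, (t < i)%N -> u i = 0%N).
Hypotheses (t2 : (2 <= t)%N) (t'E : t' = t.-1 :> nat).

Lemma listed_formP r p q : (3 <= r)%N -> (0 < q)%N ->
  'X_[u] = listed_form r p q <->
  [/\ t.+1 = r, freiman_shape u a t, u t' = p & u t = q].
Proof.
move=> r3 q0.
pose E i := (if i == 1 then 1 else if i == r then q else if i == r.-1 then p else 2)%N.
have E1 : E 1%N = 1%N by [].
have Er : E r = q by rewrite /E eqxx; case: eqP => // r1; rewrite r1 in r3.
have Er1 : E r.-1 = p.
  by rewrite /E eqxx; case: eqP => [r1|_]; [|case: eqP => // r1]; move: r3 r1; clear; lia.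
have Ei i : (1 < i < r.-1)%N -> E i = 2%N.
  by rewrite /E => ir; do 3 (case: eqP => [i1|_]; first by move: ir i1; clear; lia).
have formE : listed_form r p q = \prod_(1 <= i < r.+1) x i ^+ E i.
  rewrite big_ltn ?ltnS ?(leq_trans _ r3) // big_nat_recr ?(ltnW r3) //= Er E1 /listed_form.
  have -> : \prod_(2 <= i < r) x i ^+ E i = \prod_(2 <= i < r.-1) x i ^+ E i * x r.-1 ^+ p.
    rewrite -Er1 -(big_nat_recr _ 2 (fun i => x i ^+ E i)) ?prednK ?(leq_trans _ r3) //.
    by move: r3; clear; lia.
  rewrite expr1 !mulrA; congr (_ * _ * _ * _).
  by rewrite !big_nat; apply: eq_bigr => i ir; rewrite Ei.
have wE (i : 'I_n) : [multinom (if (i.+1 < r.+1)%N then E i.+1 else 0%N) | i < n] i =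
    (if (i < r)%N then E i.+1 else 0)%N by rewrite mnmE ltnS.
split=> [uE|[tr [ua shape] pE qE]].
  (* If r > n, then x_r is 0 and, as q > 0, so is the form, whereas a monomial is not. *)
  have [le_rn|lt_nr] := leqP r n; last first.
    move: uE; rewrite /listed_form (xvar_out lt_nr) expr0n -[q == 0%N]negbK -lt0n q0 mulr0.
    by move/eqP; rewrite (negPf (mpolyX_neq0 _ _)).
  move: uE; rewrite formE prod_xvar // => /mpolyX_inj uE.
  have {uE} uE (i : 'I_n) : u i = (if (i < r)%N then E i.+1 else 0)%N by rewrite uE wE.
  have r_gt0 : (0 < r)%N by apply: leq_trans r3.
  have lt_r1n : (r.-1 < n)%N by rewrite prednK.
  have tr : t.+1 = r.
    have lt_tr : (t < r)%N by move: ut; rewrite uE; case: ifP.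
    have := uE (Ordinal lt_r1n); rewrite /= prednK // leqnn Er.
    have [/ut0 -> q0'|] := ltnP t (Ordinal lt_r1n); first by rewrite -q0' in q0.
    by rewrite /= => le _; move: lt_tr le; clear; lia.
  have ti i : (i <= t)%N -> (i < r)%N by rewrite -tr.
  split=> //; [split| |].
  - by rewrite uE a0 r_gt0.
  - by move=> i i0 it; rewrite uE ti ?Ei -?tr //= ?ltnS ?i0 // ltnW // ltnW.
  - by rewrite uE t'E ti ?leq_pred // prednK ?(ltnW t2) // -[t in E t]/(t.+1.-1) tr.
  - by rewrite uE ti // tr.
rewrite formE prod_xvar; last by rewrite -tr !ltnS.
congr 'X_[_]; apply/mnmP => i; rewrite wE.
have [lt_ir|le_ri] := ltnP i r; last by rewrite ut0 // tr.
move: lt_ir; rewrite -tr ltnS leq_eqVlt => /predU1P[it|lt_it].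
  by rewrite it tr Er -qE; congr (u _); apply: val_inj.
have [it'|neq] := eqVneq i t'.
  by rewrite it' t'E prednK ?(ltnW t2) // -[t in E t]/(t.+1.-1) tr Er1.
have [i0|i0] := posnP i.
  by rewrite i0 E1 -ua; congr (u _); apply: val_inj; rewrite a0.
have lt_i1t : (i.+1 < t)%N.
  by move: neq lt_it; rewrite -val_eqE /= t'E; clear -t2; lia.
by rewrite shape // Ei // -tr ltnS i0.
Qed.

End ListedMonomials.

Theorem theorem3p12 (n : nat) (K : fieldType) (hn : (3 <= n)%N)
    (d : nat) (hd : (5 <= d)%N) (u : 'X_{1..n})
    (hu2 : bounded 2 u) (hud : mdeg u = d)
    (hu1 : ~ exists q : {mpoly K[n]}, 'X_[u] = xvar 1 ^+ 2 * q) :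
  let m := (d./2)%N in
  let x : nat -> {mpoly K[n]} := xvar in
  freiman (principal_borel K 2 u) <->
  [\/ 'X_[u] = if ~~ odd d
               then x 1%N * (\prod_(2 <= i < m.+1) x i ^+ 2) * x m.+1
               else x 1%N * (\prod_(2 <= i < m.+2) x i ^+ 2),
      'X_[u] = if ~~ odd d
               then x 1%N * (\prod_(2 <= i < m.+1) x i ^+ 2) * x m.+2
               else x 1%N * (\prod_(2 <= i < m.+1) x i ^+ 2) * x m.+1 * x m.+2
    | 'X_[u] = if ~~ odd d
               then x 1%N * (\prod_(2 <= i < m) x i ^+ 2) * x m * x m.+1 ^+ 2
               else x 1%N * (\prod_(2 <= i < m.+1) x i ^+ 2) * x m.+2 ^+ 2].
Proof.
move=> m x.
have n_gt0 : (0 < n)%N by apply: leq_trans hn.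
pose a : 'I_n := Ordinal n_gt0; have a0 : val a = 0%N by [].
have x1E : xvar 1 = 'X_a :> {mpoly K[n]} by rewrite -(xvar_ord K a).
have ua : (u a <= 1)%N.
  rewrite leqNgt; apply/negP => ua; apply: hu1.
  exists 'X_[u - (U_(a) + U_(a))]; rewrite x1E expr2 -!mpolyXD addmC submK //.
  apply/mnm_lepP => i; rewrite mnmDE mnm1E; case: eqP => [<-|//].
  exact: ua.
have [i0 ui0] : exists i, (0 < u i)%N.
  apply/existsP; rewrite -[X in is_true X]negbK negb_exists; apply/negP => /forallP u0.
  move: hd; rewrite -hud mdegE big1 // => i _; apply/eqP; rewrite -leqn0 leqNgt.
  exact: u0.
have [t ut tmax] := arg_maxnP (fun i : 'I_n => val i) (ui0 : (fun i => 0 < u i)%N i0).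
have ut0 (i : 'I_n) : (t < i)%N -> u i = 0%N.
  by rewrite ltnNge; apply: contraNeq; rewrite -lt0n => /tmax.
(* Otherwise the degree would be at most 1 + 2 < 5, from the first two variables. *)
have t_gt1 : (1 < t)%N.
  rewrite ltnNge; apply/negP => t1; move: hd; rewrite -hud -(psum_support ut0).
  rewrite psum_recr; have := hu2 t; have: (psum u t <= 1)%N; last by clear; lia.
  apply: leq_trans ua; case: (posnP t) => [->|t0]; first by rewrite /psum big_pred0.
  by rewrite /psum (big_pred1 a) // => i; rewrite /= -val_eqE /=; move: t0 t1; clear; lia.
have a_lt_t : (a < t)%N := ltnW t_gt1.
have Frei : freiman (principal_borel K 2 u) <-> freiman_shape u a t.
  rewrite (@freiman_principal_borel _ _ _ _ t.+1) //; last first.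
    by rewrite principal_borelE //; apply: (borel_analytic_spread (a := a) (t := t)).
  have -> : #|` sumset (borel_fset 2 u)|%:Z - t.+1%:Z * #|` borel_fset 2 u|%:Z + 'C(t.+1, 2)%:Z =
      surplus (borel_fset 2 u) by rewrite /surplus (mrank_borel (a := a) (t := t)).
  split=> [s0|shape]; last exact: (surplus_freiman_shape (a := a) (t := t)).
  have [//|/(surplus_borel_gt0 (t := t) hu2 a0 ua ut ut0 a_lt_t)] := pselect (freiman_shape u a t).
  by rewrite s0 hud ltxx => /(_ hd).
rewrite Frei => {Frei}.
pose t' : 'I_n := Ordinal (leq_ltn_trans (leq_pred t) (ltn_ord t)).
have formP := listed_formP K (t' := t') a0 ut ut0 t_gt1 erefl.
have mE : d = (odd d + m.*2)%N by rewrite odd_double_half.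
have m2 : (2 <= m)%N by move: hd; rewrite mE; case: (odd d); clear; lia.
pose form := @listed_form K n.
have mE' : m = m.-2.+2 by move: m2; clear; lia.
have f1e : x 1%N * (\prod_(2 <= i < m.+1) x i ^+ 2) * x m.+1 = form m.+1 2 1.
  by rewrite /form /listed_form big_nat_recr // expr1 !mulrA.
have f1o : x 1%N * (\prod_(2 <= i < m.+2) x i ^+ 2) = form m.+1 2 2.
  by rewrite /form /listed_form !big_nat_recr ?(leqW m2) //= !mulrA.
have f2e : x 1%N * (\prod_(2 <= i < m.+1) x i ^+ 2) * x m.+2 = form m.+2 0 1.
  by rewrite /form /listed_form expr0 expr1 mulr1.
have f2o : x 1%N * (\prod_(2 <= i < m.+1) x i ^+ 2) * x m.+1 * x m.+2 = form m.+2 1 1.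
  by rewrite /form /listed_form !expr1.
have f3e : x 1%N * (\prod_(2 <= i < m) x i ^+ 2) * x m * x m.+1 ^+ 2 = form m.+1 1 2.
  by rewrite /form /listed_form expr1.
have f3o : x 1%N * (\prod_(2 <= i < m.+1) x i ^+ 2) * x m.+2 ^+ 2 = form m.+2 0 2.
  by rewrite /form /listed_form expr0 mulr1.
rewrite f2o f1e f1o f2e f3e f3o {f1e f1o f2e f2o f3e f3o}.
have dE : freiman_shape u a t -> (d.+1 = 2 * t.-1 + u t' + u t)%N.
  by move=> shape; rewrite -hud; apply: (mdeg_freiman_shape (a := a) (t := t)).
have form_shape r p q : 'X_[u] = form r p q -> (3 <= r)%N -> (0 < q)%N -> freiman_shape u a t.
  by move=> uE r3 q0; case: ((formP r p q r3 q0).1 uE).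
split=> [shape|]; last first.
  by case: (odd d) => /= -[] /form_shape; apply=> //; apply: leqW.
have {dE} dE := dE shape; have := hu2 t'; have := hu2 t.
have choose p q r : u t' = p -> u t = q -> t.+1 = r -> 'X_[u] = form r p q.
  by move=> pE qE rE; apply/formP; rewrite -?rE // -qE.
(* In d + 1 = 2(t - 1) + p + q the parity of d leaves three pairs (p, q): (2,1), (0,1), (1,2) for
   even d and (2,2), (1,1), (0,2) for odd d, in the order of the three cases. Then t follows. *)
move: choose dE mE ut t_gt1; case: (odd d) => /=; rewrite -mul2n;
  case: (u t') => [|[|[|//]]]; case: (u t) => [//|[|[|//]]] choose dE mE _ t1 _ _;
  try (exfalso; move: dE mE t1; clear; lia).
- by apply: Or33; apply: choose => //; move: dE mE t1; clear; lia.
- by apply: Or32; apply: choose => //; move: dE mE t1; clear; lia.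
- by apply: Or31; apply: choose => //; move: dE mE t1; clear; lia.
- by apply: Or32; apply: choose => //; move: dE mE t1; clear; lia.
- by apply: Or33; apply: choose => //; move: dE mE t1; clear; lia.
- by apply: Or31; apply: choose => //; move: dE mE t1; clear; lia.
Qed.
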